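(* Let $(F_n,\rho_{n+1,n})_n$ be a $\mathrm{CPC}^*$-system and let $X\subset F_\infty$ be its limit. Then there exists an associative bilinear map $\bullet\colon X\times X\longrightarrow X$ satisfying $$\rho_k(x)\bullet\rho_k(y)=\lim_n \rho_n\big(\rho_{n,k}(x)\rho_{n,k}(y)\big)$$ for all $k\geq 0$ and $x,y\in F_k$, so that $(X,\bullet)$ is a $\mathrm{C}^*$-algebra with the involution and norm inherited as a subspace of $F_\infty$.
   Context: ''c.p.c.'' means completely positive and contractive. Let $(F_n)_{n\geq 0}$ be a sequence of finite-dimensional $\mathrm{C}^*$-algebras with c.p.c. maps $\rho_{n+1,n}\colon F_n\to F_{n+1}$. For $m>n\ge 0$ put $\rho_{m,n}:=\rho_{m,m-1}\circ\cdots\circ\rho_{n+1,n}$ and $\rho_{n,n}:=\mathrm{id}_{F_n}$. Let $F_\infty:=\prod_n F_n/\bigoplus_n F_n$ be the $\mathrm{C}^*$-algebra of norm-bounded sequences modulo null sequences, with elements written $[(x_n)_n]$. Define $\rho_n\colon F_n\to F_\infty$ by $\rho_n(x)=[(\rho_{m,n}(x))_{m>n}]$. The limit of the system is the closed self-adjoint subspace $X:=\overline{\bigcup_n\rho_n(F_n)}\subset F_\infty$. The system $(F_n,\rho_{n+1,n})_n$ is a $\mathrm{CPC}^*$-system if for any $k\ge 0$, $x,y\in F_k$ and $\varepsilon>0$ there is $M>k$ such that for all $m,n,l$ with $m>n>M$ and $m>l>M$, $$\|\rho_{m,l}(1_{F_l})\,\rho_{m,n}(\rho_{n,k}(x)\rho_{n,k}(y))-\rho_{m,k}(x)\rho_{m,k}(y)\|<\varepsilon.$$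 *)

(* Defs.v *)
From HB Require Import structures.
From mathcomp Require Import all_boot all_order all_algebra.
From mathcomp Require Import all_classical all_reals all_analysis.
From mathcomp Require Import complex.

Set Implicit Arguments.
Unset Strict Implicit.
Unset Printing Implicit Defensive.

Import Order.TTheory GRing.Theory Num.Theory.
Import numFieldNormedType.Exports.

Local Open Scope classical_set_scope.
Local Open Scope complex_scope.
Local Open Scope quotient_scope.
Local Open Scope ring_scope.

(* A is a complex normed space, so its norm takes its (nonnegative real) values
   in R[i].  No identity element is required: C*-algebras may be non-unital.
   The completeness clause is the axiom of completeType. *)
Record cstar_algebra (R : realType) (A : normedModType R[i])
    (mul : A -> A -> A) (star : A -> A) : Prop := CStarAlgebra {
  cstar_mulA : associative mul ;
  cstar_mul_linearr : forall x, linear (mul x) ;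
  cstar_mul_linearl : forall y, linear (mul^~ y) ;
  cstar_starK : involutive star ;
  cstar_star_semilinear : forall (a : R[i]) x y,
    star (a *: x + y) = conjc a *: star x + star y ;
  cstar_starM : forall x y, star (mul x y) = mul (star y) (star x) ;
  cstar_normM : forall x y, `|mul x y| <= `|x| * `|y| ;
  cstar_norm_starM : forall x, `|mul (star x) x| = `|x| ^+ 2 ;
  cstar_complete : forall F : set_system A, ProperFilter F -> cauchy F -> cvg F }.

(* A finite-dimensional C*-algebra always has a (unique) identity; fdc_one names
   it.  The zero algebra is allowed (then fdc_one = 0). *)
Structure fdCStarAlg (R : realType) := FDCStarAlg {
  fdc_sort :> normedModType R[i] ;
  fdc_mul : fdc_sort -> fdc_sort -> fdc_sort ;
  fdc_star : fdc_sort -> fdc_sort ;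
  fdc_one : fdc_sort ;
  fdc_cstar : cstar_algebra fdc_mul fdc_star ;
  fdc_mul1 : left_id fdc_one fdc_mul ;
  fdc_mulr1 : right_id fdc_one fdc_mul ;
  fdc_findim : exists d (e : 'I_d -> fdc_sort), forall x,
    exists c : 'I_d -> R[i], x = \sum_i c i *: e i }.

(* Positivity in the C*-algebra M_r(A), i.e. being of the form b^* b. *)
Definition positive_mx (R : realType) (A : fdCStarAlg R) r (a : 'M[A]_r) : Prop :=
  exists b : 'M[A]_r,
    a = \matrix_(i, j) \sum_k fdc_mul (fdc_star (b k i)) (b k j).

Definition completely_positive (R : realType) (A B : fdCStarAlg R) (f : A -> B) :=
  forall r (a : 'M[A]_r), positive_mx a -> positive_mx (map_mx f a).

Structure cpc_system (R : realType) := CPCSystem {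
  sys_alg :> nat -> fdCStarAlg R ;
  sys_step : forall n, {linear sys_alg n -> sys_alg n.+1} ;
  sys_step_cp : forall n, completely_positive (sys_step n) ;
  sys_step_contractive : forall n x, `|sys_step n x| <= `|x| }.

Section RealNorm.
Variable R : realType.

Definition rnorm (V : normedModType R[i]) (v : V) : R := complex.Re `|v|.

Lemma rnormE (V : normedModType R[i]) (v : V) : `|v| = (rnorm v)%:C.
Proof. by rewrite /rnorm RRe_real ?normr_real. Qed.

Lemma rnorm_ge0 (V : normedModType R[i]) (v : V) : 0 <= rnorm v.
Proof. by rewrite -ler0c -rnormE normr_ge0. Qed.

Lemma ler_rnormD (V : normedModType R[i]) (u v : V) :
  rnorm (u + v) <= rnorm u + rnorm v.
Proof. by rewrite -lecR rmorphD /= -!rnormE ler_normD. Qed.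

Lemma rnormN (V : normedModType R[i]) (v : V) : rnorm (- v) = rnorm v.
Proof. by rewrite /rnorm normrN. Qed.

Lemma rnorm0 (V : normedModType R[i]) : rnorm (0 : V) = 0.
Proof. by rewrite /rnorm normr0. Qed.

Definition cnorm (a : R[i]) : R := complex.Re `|a|.

Lemma cnormE (a : R[i]) : `|a| = (cnorm a)%:C.
Proof. by rewrite /cnorm RRe_real ?normr_real. Qed.

Lemma cnorm_ge0 (a : R[i]) : 0 <= cnorm a.
Proof. by rewrite -ler0c -cnormE normr_ge0. Qed.

Lemma rnormZ (V : normedModType R[i]) a (v : V) :
  rnorm (a *: v) = cnorm a * rnorm v.
Proof. by apply: complexI; rewrite rmorphM /= -cnormE -!rnormE normrZ. Qed.

End RealNorm.

Section BoundedSequences.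
Variables (R : realType) (F : nat -> normedModType R[i]).

(* The norm-bounded elements of \prod_n F n. *)
Record bseq := BSeq {
  bseq_val :> forall n, F n ;
  bseq_bounded : exists M : R, forall n, `|bseq_val n| <= M%:C }.

HB.instance Definition _ := gen_eqMixin bseq.
HB.instance Definition _ := gen_choiceMixin bseq.

Lemma bseqP (x y : bseq) : (forall n, x n = y n) -> x = y.
Proof.
case: x y => [x xb] [y yb] /= xy.
have {}xy : x = y by exact: functional_extensionality_dep.
by move: yb; rewrite -xy => yb; congr BSeq; exact: Prop_irrelevance.
Qed.

Fact bseq0_subproof : exists M : R, forall n, `|0 : F n| <= M%:C.
Proof. by exists 0 => n; rewrite normr0. Qed.
Definition bseq0 := BSeq bseq0_subproof.

Fact bseqN_subproof (x : bseq) : exists M : R, forall n, `|- x n| <= M%:C.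
Proof. by have [M xM] := bseq_bounded x; exists M => n; rewrite normrN. Qed.
Definition bseqN x := BSeq (bseqN_subproof x).

Fact bseqD_subproof (x y : bseq) : exists M : R, forall n, `|x n + y n| <= M%:C.
Proof.
have [M xM] := bseq_bounded x; have [N yN] := bseq_bounded y.
exists (M + N) => n; rewrite rmorphD /=.
by apply: le_trans (ler_normD _ _) _; exact: lerD.
Qed.
Definition bseqD x y := BSeq (bseqD_subproof x y).

Fact bseqZ_subproof (a : R[i]) (x : bseq) :
  exists M : R, forall n, `|a *: x n| <= M%:C.
Proof.
have [M xM] := bseq_bounded x.
exists (cnorm a * M) => n.
by rewrite rnormE rnormZ lecR ler_wpM2l ?cnorm_ge0// -lecR -rnormE.
Qed.
Definition bseqZ a x := BSeq (bseqZ_subproof a x).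

Fact bseq_addA : associative bseqD.
Proof. by move=> x y z; apply/bseqP => n /=; rewrite addrA. Qed.
Fact bseq_addC : commutative bseqD.
Proof. by move=> x y; apply/bseqP => n /=; rewrite addrC. Qed.
Fact bseq_add0 : left_id bseq0 bseqD.
Proof. by move=> x; apply/bseqP => n /=; rewrite add0r. Qed.
Fact bseq_addN : left_inverse bseq0 bseqN bseqD.
Proof. by move=> x; apply/bseqP => n /=; rewrite addNr. Qed.
HB.instance Definition _ :=
  GRing.isZmodule.Build bseq bseq_addA bseq_addC bseq_add0 bseq_addN.

Fact bseq_scaleA a b x : bseqZ a (bseqZ b x) = bseqZ (a * b) x.
Proof. by apply/bseqP => n /=; rewrite scalerA. Qed.
Fact bseq_scale1 : left_id 1 bseqZ.
Proof. by move=> x; apply/bseqP => n /=; rewrite scale1r. Qed.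
Fact bseq_scaleDr : right_distributive bseqZ +%R.
Proof. by move=> a x y; apply/bseqP => n /=; rewrite scalerDr. Qed.
Fact bseq_scaleDl x : {morph bseqZ^~ x : a b / a + b}.
Proof. by move=> a b; apply/bseqP => n /=; rewrite scalerDl. Qed.
HB.instance Definition _ := GRing.Zmodule_isLmodule.Build R[i] bseq
  bseq_scaleA bseq_scale1 bseq_scaleDr bseq_scaleDl.

(* Membership in \bigoplus_n F n. *)
Definition is_null (x : bseq) : bool :=
  `[< (fun n => rnorm (x n)) @ \oo --> (0 : R) >].

Lemma is_nullP (x : bseq) : reflect
  (forall e, 0 < e -> \forall n \near \oo, rnorm (x n) < e) (is_null x).
Proof.
apply: (iffP (asboolP _)) => [/cvgrPdist_lt x0 e e0|x0].
  have := x0 _ e0; apply: filterS => n; rewrite sub0r normrN.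
  by rewrite ger0_norm ?rnorm_ge0.
apply/cvgrPdist_lt => e /x0; apply: filterS => n.
by rewrite sub0r normrN ger0_norm ?rnorm_ge0.
Qed.

Fact is_null_zmod_closed : zmod_closed is_null.
Proof.
split=> [|x y /is_nullP x0 /is_nullP y0].
  by apply/is_nullP => e e0; near=> n; rewrite rnorm0.
apply/is_nullP => e e0.
have e2 : 0 < e / 2 by rewrite divr_gt0.
near=> n; rewrite [ltRHS]splitr.
apply: le_lt_trans (ler_rnormD _ _) _.
rewrite rnormN; apply: ltrD; near: n; [exact: x0|exact: y0].
Unshelve. all: by end_near. Qed.
HB.instance Definition _ := GRing.isZmodClosed.Build bseq is_null
  is_null_zmod_closed.

Fact is_null_scale a (x : bseq) : is_null x -> is_null (a *: x).
Proof.
move=> /is_nullP x0; apply/is_nullP => e e0.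
have a0 : 0 < cnorm a + 1 by rewrite ltr_wpDl ?cnorm_ge0.
have ea : 0 < e / (cnorm a + 1) by rewrite divr_gt0.
near=> n; rewrite rnormZ.
apply: (@le_lt_trans _ _ ((cnorm a + 1) * rnorm (x n))).
  by apply: ler_wpM2r; rewrite ?rnorm_ge0 ?lerDl.
rewrite mulrC -ltr_pdivlMr//; near: n; exact: x0.
Unshelve. all: by end_near. Qed.

(* \prod_n F n / \bigoplus_n F n, as a complex vector space; it is given below
   the quotient norm, and an involution when the F n are C*-algebras.  Its
   product is not needed. *)
Definition corona : Type :=
  Quotient.quot (GRing.ZmodClosed.clone bseq is_null _).
HB.instance Definition _ := GRing.Zmodule.on corona.

Definition cls (x : bseq) : corona :=
  \pi_(Quotient.quot (GRing.ZmodClosed.clone bseq is_null _)) x.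

Lemma clsP (x y : bseq) : (cls x = cls y) <-> is_null (x - y).
Proof.
rewrite /cls; split => [/eqP|h]; last apply/eqP; by rewrite -Quotient.idealrBE.
Qed.

Lemma cls_repr (q : corona) : exists x, q = cls x.
Proof. by exists (repr q); rewrite /cls reprK. Qed.

Lemma clsB : {morph cls : x y / x - y}.
Proof. by move=> x y; rewrite /cls raddfB. Qed.

Lemma clsD : {morph cls : x y / x + y}.
Proof. by move=> x y; rewrite /cls raddfD. Qed.

Definition corona_scale (a : R[i]) (q : corona) : corona := cls (a *: repr q).

Lemma clsZ a x : cls (a *: x) = corona_scale a (cls x).
Proof.
apply/clsP; rewrite -scalerBr; apply: is_null_scale; apply/clsP.
by rewrite [RHS]reprK.
Qed.

Fact corona_scaleA a b q : corona_scale a (corona_scale b q) = corona_scale (a * b) q.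
Proof. by have [x ->] := cls_repr q; rewrite -!clsZ scalerA. Qed.
Fact corona_scale1 : left_id 1 corona_scale.
Proof. by move=> q; have [x ->] := cls_repr q; rewrite -!clsZ scale1r. Qed.
Fact corona_scaleDr : right_distributive corona_scale +%R.
Proof.
move=> a p q; have [x ->] := cls_repr p; have [y ->] := cls_repr q.
by rewrite -clsD -!clsZ -clsD scalerDr.
Qed.
Fact corona_scaleDl q : {morph corona_scale^~ q : a b / a + b}.
Proof.
by move=> a b; have [x ->] := cls_repr q; rewrite -!clsZ -clsD scalerDl.
Qed.
HB.instance Definition _ := GRing.Zmodule_isLmodule.Build R[i] corona
  corona_scaleA corona_scale1 corona_scaleDr corona_scaleDl.

Definition sup_norm (x : bseq) : R := sup (range (fun n => rnorm (x n))).

(* The quotient norm: infimum of the sup norm over the representatives of q. *)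
Definition corona_norm (q : corona) : R :=
  inf [set sup_norm x | x in [set x | cls x = q]].

Lemma sup_norm_ub (x : bseq) n : rnorm (x n) <= sup_norm x.
Proof.
apply: ub_le_sup; last by exists n.
have [M xM] := bseq_bounded x; exists M => _ [m _ <-].
by rewrite -lecR -rnormE.
Qed.

Lemma sup_norm_le (x : bseq) M : (forall n, rnorm (x n) <= M) -> sup_norm x <= M.
Proof.
by move=> xM; apply: ge_sup => [|_ [n _ <-]//]; exists (rnorm (x 0%N)), 0%N.
Qed.

Lemma sup_norm_ge0 (x : bseq) : 0 <= sup_norm x.
Proof. exact: le_trans (rnorm_ge0 (x 0%N)) (sup_norm_ub x 0%N). Qed.

Lemma corona_norm_le (x : bseq) : corona_norm (cls x) <= sup_norm x.
Proof.
by apply: ge_inf; [exists 0 => _ [y _ <-]; exact: sup_norm_ge0|exists x].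
Qed.

Lemma corona_norm_ge0 q : 0 <= corona_norm q.
Proof.
apply: lb_le_inf => [|_ [y _ <-]]; last exact: sup_norm_ge0.
by have [x ->] := cls_repr q; exists (sup_norm x); exists x.
Qed.

Lemma corona_norm_lt q e : corona_norm q < e -> exists2 x, q = cls x & sup_norm x < e.
Proof.
move=> qe; have [|_ [x /= <- <-] xe] := inf_lt _ qe; last by exists x.
by have [x ->] := cls_repr q; exists (sup_norm x); exists x.
Qed.

Fact corona_normD p q : corona_norm (p + q) <= corona_norm p + corona_norm q.
Proof.
apply/ler_addgt0Pr => e e0; have e2 : 0 < e / 2 by rewrite divr_gt0.
have /corona_norm_lt[x -> xe] : corona_norm p < corona_norm p + e / 2.
  by rewrite ltrDl.
have /corona_norm_lt[y -> ye] : corona_norm q < corona_norm q + e / 2.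
  by rewrite ltrDl.
rewrite -clsD; apply: le_trans (corona_norm_le _) _.
apply: (@le_trans _ _ (sup_norm x + sup_norm y)).
  apply: sup_norm_le => n; apply: le_trans (ler_rnormD _ _) _.
  by apply: lerD; exact: sup_norm_ub.
by rewrite [in leRHS](splitr e) addrACA; apply: lerD; exact: ltW.
Qed.

Lemma cls0 : cls 0 = 0. Proof. by rewrite -[0 in LHS](subrr 0) clsB subrr. Qed.

Fact corona_norm0 : corona_norm 0 = 0.
Proof.
apply/eqP; rewrite eq_le corona_norm_ge0 andbT -cls0.
apply: le_trans (corona_norm_le _) _.
by apply: sup_norm_le => n; rewrite rnorm0.
Qed.

Fact corona_normZ_le a q : corona_norm (a *: q) <= cnorm a * corona_norm q.
Proof.
have [->|a0] := eqVneq a 0.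
  by rewrite scale0r corona_norm0 mulr_ge0 ?cnorm_ge0 ?corona_norm_ge0.
have c0 : 0 < cnorm a by rewrite -ltcR -cnormE normr_gt0.
rewrite mulrC -ler_pdivrMr//; apply: lb_le_inf => [|_ [x /= <- <-]].
  by have [x ->] := cls_repr q; exists (sup_norm x); exists x.
rewrite ler_pdivrMr// -[a *: _]clsZ.
apply: le_trans (corona_norm_le _) _.
apply: sup_norm_le => n; rewrite [bseq_val _ _]/= rnormZ mulrC.
by apply: ler_wpM2r; rewrite ?cnorm_ge0 ?sup_norm_ub.
Qed.

Fact corona_normZ a q : corona_norm (a *: q) = cnorm a * corona_norm q.
Proof.
apply/eqP; rewrite eq_le corona_normZ_le andTb.
have [->|a0] := eqVneq a 0.
  have -> : cnorm (0 : R[i]) = 0 by rewrite /cnorm normr0.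
  by rewrite mul0r corona_norm_ge0.
have c0 : 0 < cnorm a by rewrite -ltcR -cnormE normr_gt0.
rewrite -ler_pdivlMl// -{1}[q](scalerK a0).
apply: le_trans (corona_normZ_le _ _) _.
suff -> : cnorm a^-1 = (cnorm a)^-1 by [].
by apply: complexI; rewrite fmorphV /= -!cnormE normfV.
Qed.

Fact corona_norm0_eq0 q : corona_norm q = 0 -> q = 0.
Proof.
have [x ->] := cls_repr q => x0; rewrite -cls0; apply/clsP/is_nullP => e e0.
have e2 : 0 < e / 2 by rewrite divr_gt0.
have /corona_norm_lt[y /clsP/is_nullP xy ye] : corona_norm (cls x) < e / 2.
  by rewrite x0.
near=> n; rewrite subr0.
have -> : x n = (x - y) n + y n by rewrite /= subrK.
rewrite (splitr e); apply: le_lt_trans (ler_rnormD _ _) _; apply: ltrD.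
  by near: n; exact: xy.
exact: le_lt_trans (sup_norm_ub y n) ye.
Unshelve. all: by end_near. Qed.

Fact corona_normcD p q :
  (corona_norm (p + q))%:C <= (corona_norm p)%:C + (corona_norm q)%:C.
Proof. by rewrite -rmorphD lecR corona_normD. Qed.
Fact corona_normcZ a q : (corona_norm (a *: q))%:C = `|a| * (corona_norm q)%:C.
Proof. by rewrite corona_normZ rmorphM /= -cnormE. Qed.
Fact corona_normc0_eq0 q : (corona_norm q)%:C = 0 -> q = 0.
Proof. by move=> /complexI; exact: corona_norm0_eq0. Qed.
HB.instance Definition _ := Lmodule_isNormed.Build R[i] corona
  corona_normcD corona_normcZ corona_normc0_eq0.

Lemma rnorm_corona (q : corona) : rnorm q = corona_norm q.
Proof. by []. Qed.

End BoundedSequences.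

Section CStarTheory.
Variables (R : realType) (A : normedModType R[i]).
Variables (mul : A -> A -> A) (star : A -> A).
Hypothesis cA : cstar_algebra mul star.

Lemma cstar_star0 : star 0 = 0.
Proof.
have := cstar_star_semilinear cA 1 0 0.
rewrite scale1r addr0 rmorph1 scale1r => /eqP.
by rewrite -[X in X == _]addr0 (inj_eq (addrI _)) eq_sym => /eqP.
Qed.

Lemma cstar_starD x y : star (x + y) = star x + star y.
Proof.
by have := cstar_star_semilinear cA 1 x y; rewrite rmorph1 !scale1r.
Qed.

Lemma cstar_starZ a x : star (a *: x) = conjc a *: star x.
Proof.
by have := cstar_star_semilinear cA a x 0; rewrite cstar_star0 !addr0.
Qed.

Lemma cstar_starB x y : star (x - y) = star x - star y.
Proof.
by rewrite cstar_starD -scaleN1r cstar_starZ rmorphN rmorph1 scaleN1r.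
Qed.

Lemma cstar_norm_star x : `|star x| = `|x|.
Proof.
suff le z : `|z| <= `|star z|.
  by apply/eqP; rewrite eq_le le andbT -{2}(cstar_starK cA x) le.
have [->|z0] := eqVneq z 0; first by rewrite normr0 normr_ge0.
have zgt0 : 0 < `|z| by rewrite normr_gt0.
by rewrite -(ler_pM2r zgt0) -expr2 -(cstar_norm_starM cA) (cstar_normM cA).
Qed.

End CStarTheory.

Section Selfadjoint.
Variable R : realType.

Lemma fdc_star1 (A : fdCStarAlg R) : fdc_star (fdc_one A) = fdc_one A.
Proof.
have cA := fdc_cstar A.
by rewrite -[LHS](fdc_mul1 (f := A)) -{1}[fdc_one A](cstar_starK cA)
  -(cstar_starM cA) fdc_mul1 (cstar_starK cA).
Qed.

Lemma positive_mx_star (A : fdCStarAlg R) r (a : 'M[A]_r) i j :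
  positive_mx a -> fdc_star (a i j) = a j i.
Proof.
have cA := fdc_cstar A.
move=> [b ->]; rewrite !mxE.
rewrite (big_morph _ (cstar_starD cA) (cstar_star0 cA)).
by apply: eq_bigr => k _; rewrite (cstar_starM cA) (cstar_starK cA).
Qed.

Lemma completely_positive_star (A B : fdCStarAlg R) (f : A -> B) (x : A) :
  completely_positive f -> f (fdc_star x) = fdc_star (f x).
Proof.
have cA := fdc_cstar A.
move=> fcp.
pose b : 'M[A]_2 := \matrix_(i, j)
  if i == 0 then (if j == 0 then fdc_one A else x) else 0.
pose a : 'M[A]_2 := \matrix_(i, j) \sum_k fdc_mul (fdc_star (b k i)) (b k j).
have pa : positive_mx a by exists b.
have mul0x y : fdc_mul 0 y = 0 :> A.
  have := cstar_mul_linearl cA y (-1) 0 0.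
  by rewrite scaler0 addr0 scaleN1r addNr.
have a01 : a 0 1 = x.
  rewrite !mxE big_ord_recl big_ord1 !mxE /=.
  by rewrite fdc_star1 fdc_mul1 (cstar_star0 cA) mul0x addr0.
have := positive_mx_star 0 1 (fcp _ _ pa).
rewrite [map_mx f a 0 1]mxE [map_mx f a 1 0]mxE.
by rewrite -(positive_mx_star 0 1 pa) a01.
Qed.

End Selfadjoint.

Section Transition.
Variables (R : realType) (S : cpc_system R).

(* trans m n : S n -> S m is the composite sys_step m.-1 \o ... \o sys_step n for
   n <= m; the value for m < n is the dummy 0.  See trans_id, transS, trans_lt. *)
Fixpoint trans (m n : nat) : S n -> S m :=
  match m return S n -> S m with
  | 0 => fun x => if n =P 0%N is ReflectT e then ecast i (S i) e x else 0
  | m'.+1 => fun x => if n =P m'.+1 is ReflectT e then ecast i (S i) e x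
                      else sys_step S m' (@trans m' n x)
  end.

Arguments trans m n x : clear implicits.

Lemma trans_id n x : trans n n x = x.
Proof.
case: n x => [|n] x /=; case: eqP => // e; by rewrite eq_axiomK.
Qed.

Lemma transS m n x : (n <= m)%N -> trans m.+1 n x = sys_step S m (trans m n x).
Proof. by move=> nm /=; case: eqP => // e; rewrite e ltnn in nm. Qed.

Lemma trans_lt m n x : (m < n)%N -> trans m n x = 0.
Proof.
elim: m => [|m IH] mn /=; case: eqP => [e|_] //.
- by rewrite e ltnn in mn.
- by rewrite e ltnn in mn.
- by rewrite IH ?linear0// ltnW.
Qed.

Lemma trans_linear m n : linear (trans m n).
Proof.
move=> a x y; elim: m => [|m IH] /=; case: eqP => [e|_].
- by case: _ / e.
- by rewrite scaler0 addr0.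
- by case: _ / e.
- by rewrite IH linearP.
Qed.

Lemma trans_comp m n k x : (k <= n)%N -> (n <= m)%N ->
  trans m n (trans n k x) = trans m k x.
Proof.
move=> kn; elim: m => [|m IH]; first by rewrite leqn0 => /eqP ->; rewrite trans_id.
rewrite leq_eqVlt => /orP[/eqP <-|]; first by rewrite trans_id.
by rewrite ltnS => nm; rewrite !transS ?IH// (leq_trans kn).
Qed.

Lemma trans_contractive m n x : `|trans m n x| <= `|x|.
Proof.
have [nm|mn] := leqP n m; last by rewrite trans_lt// normr0.
rewrite -(subnK nm); elim: (m - n)%N => [|d IH]; first by rewrite trans_id.
rewrite addSn transS ?leq_addl//.
by apply: le_trans IH; exact: sys_step_contractive.
Qed.

Lemma trans_star m n x : trans m n (fdc_star x) = fdc_star (trans m n x).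
Proof.
have [nm|mn] := leqP n m; last first.
  by rewrite !trans_lt// (cstar_star0 (fdc_cstar _)).
rewrite -(subnK nm); elim: (m - n)%N => [|d IH]; first by rewrite !trans_id.
rewrite addSn !transS ?leq_addl// IH.
by apply: completely_positive_star; exact: sys_step_cp.
Qed.

Definition cpcstar_system : Prop :=
  forall (k : nat) (x y : S k) (eps : R), 0 < eps ->
  exists2 M, (k < M)%N & forall m n l, (M < n < m)%N -> (M < l < m)%N ->
    `| fdc_mul (trans m l (fdc_one (S l)))
         (trans m n (fdc_mul (trans n k x) (trans n k y)))
       - fdc_mul (trans m k x) (trans m k y) | < eps%:C.

Definition sys_corona := corona (fun n => fdc_sort (S n)).
HB.instance Definition _ := NormedModule.on sys_corona.

Fact bseq_star_subproof (x : bseq (fun n => fdc_sort (S n))) :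
  exists M : R, forall n, `|fdc_star (x n)| <= M%:C.
Proof.
have [M xM] := bseq_bounded x; exists M => n.
by rewrite (cstar_norm_star (fdc_cstar _)).
Qed.
Definition bseq_star x := BSeq (bseq_star_subproof x).

Definition corona_star (q : sys_corona) : sys_corona := cls (bseq_star (repr q)).

Lemma cls_star x : cls (bseq_star x) = corona_star (cls x).
Proof.
have xr : cls x = cls (repr (cls x)) by rewrite [RHS]reprK.
apply/clsP/is_nullP => e e0.
have /clsP/is_nullP/(_ _ e0) := xr; apply: filterS => n /=.
by rewrite -(cstar_starB (fdc_cstar _)) /rnorm (cstar_norm_star (fdc_cstar _)).
Qed.

Lemma rnorm_corona_star q : rnorm (corona_star q) <= rnorm q.
Proof.
rewrite !rnorm_corona; apply: lb_le_inf => [|_ [x /= <- <-]].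
  by have [x ->] := cls_repr q; exists (sup_norm x); exists x.
rewrite -cls_star; apply: le_trans (corona_norm_le _) _.
apply: sup_norm_le => n /=; rewrite /rnorm (cstar_norm_star (fdc_cstar _)).
exact: sup_norm_ub.
Qed.

Lemma corona_starB p q : corona_star (p - q) = corona_star p - corona_star q.
Proof.
have [x ->] := cls_repr p; have [y ->] := cls_repr q.
rewrite -clsB -!cls_star -clsB; congr cls; apply/bseqP => n /=.
by rewrite (cstar_starB (fdc_cstar _)).
Qed.

Fact rho_subproof n (x : S n) : exists M : R, forall m, `|trans m n x| <= M%:C.
Proof. by exists (rnorm x) => m; rewrite -rnormE trans_contractive. Qed.
(* The class of (trans m n x)_m.  The entries with m <= n do not affect it. *)
Definition rho n (x : S n) : sys_corona := cls (BSeq (rho_subproof x)).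

Lemma rho_linear n : linear (@rho n).
Proof.
move=> a x y; rewrite /rho.
rewrite -[a *: cls _]clsZ -clsD; congr cls; apply/bseqP => m /=.
exact: trans_linear.
Qed.

Lemma rho_trans m n x : (n <= m)%N -> rho (trans m n x) = rho x.
Proof.
move=> nm; apply/clsP/is_nullP => e e0; near=> k => /=.
by rewrite trans_comp ?subrr ?rnorm0//; near: k; exact: nbhs_infty_ge.
Unshelve. all: by end_near. Qed.

Lemma rho_star n x : rho (fdc_star x) = corona_star (rho (x : S n)).
Proof.
rewrite -cls_star; congr cls; apply/bseqP => m /=; exact: trans_star.
Qed.

Definition limit_set : set sys_corona :=
  closure (\bigcup_n range (@rho n)).

Lemma limit_setP q : limit_set q <->
  forall e : R, 0 < e -> exists n (x : S n), rnorm (q - rho x) < e.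
Proof.
split=> [cq e e0|cq B /nbhs_ballP[e /= e0 eB]].
  have [|_ [[n _ [x _ <-]] qx]] := cq (ball q e%:C).
    by apply: nbhsx_ballx; rewrite ltcR.
  exists n, x; move: qx; rewrite -ball_normE /= rnormE.
  by rewrite ltcR.
have er : e = (complex.Re e)%:C by rewrite RRe_real ?gtr0_real.
have /cq[n [x qx]] : 0 < complex.Re e by rewrite -ltcR -er.
exists (rho x); split; first by exists n => //; exists x.
by apply: eB; rewrite -ball_normE /= rnormE er ltcR.
Qed.

Definition in_limit (q : sys_corona) : bool := `[< limit_set q >].

Fact in_limit_submod_closed : submod_closed in_limit.
Proof.
split=> [|a p q /asboolP/limit_setP Lp /asboolP/limit_setP Lq].
  apply/asboolP/limit_setP => e e0; exists 0%N, 0.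
  have -> : rho (0 : S 0%N) = 0.
    have := rho_linear (-1) (0 : S 0%N) 0.
    by rewrite scaler0 addr0 scaleN1r addNr.
  by rewrite subrr rnorm0.
apply/asboolP/limit_setP => e e0.
have e2 : 0 < e / 2 by rewrite divr_gt0.
have a0 : 0 < cnorm a + 1 by rewrite ltr_wpDl ?cnorm_ge0.
have ea : 0 < e / 2 / (cnorm a + 1) by rewrite divr_gt0.
have [n [x px]] := Lp _ ea; have [m [y qy]] := Lq _ e2.
pose k := maxn n m.
exists k, (a *: trans k n x + trans k m y).
rewrite rho_linear !rho_trans ?leq_maxl ?leq_maxr//.
rewrite opprD addrACA -scalerBr [ltRHS]splitr.
apply: le_lt_trans (ler_rnormD _ _) _; apply: ltrD => //.
rewrite rnormZ.
apply: (@le_lt_trans _ _ ((cnorm a + 1) * rnorm (p - rho x))).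
  by apply: ler_wpM2r; rewrite ?rnorm_ge0 ?lerDl.
by rewrite mulrC -ltr_pdivlMr.
Qed.
HB.instance Definition _ := GRing.isSubmodClosed.Build R[i] sys_corona in_limit
  in_limit_submod_closed.

(* The limit as a normed space with the norm of sys_corona; limit_star and
   limit_rho are corona_star and rho with values in it. *)
Record limit := Limit { limit_val : sys_corona ; limit_valP : in_limit limit_val }.
HB.instance Definition _ := [isSub for limit_val].
HB.instance Definition _ := [Choice of limit by <:].
HB.instance Definition _ := [SubChoice_isSubLmodule of limit by <:].

Fact limit_normD (x y : limit) : `|val (x + y)| <= `|val x| + `|val y|.
Proof. by rewrite raddfD ler_normD. Qed.
Fact limit_normZ a (x : limit) : `|val (a *: x)| = `|a| * `|val x|.
Proof. by rewrite linearZ normrZ. Qed.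
Fact limit_norm0_eq0 (x : limit) : `|val x| = 0 -> x = 0.
Proof. by move=> /normr0_eq0 x0; apply: val_inj; rewrite raddf0. Qed.
HB.instance Definition _ := Lmodule_isNormed.Build R[i] limit
  limit_normD limit_normZ limit_norm0_eq0.

Lemma limit_normE (x : limit) : `|x| = `|limit_val x|.
Proof. by []. Qed.

Fact limit_star_subproof (x : limit) : in_limit (corona_star (limit_val x)).
Proof.
case: x => q /= /asboolP/limit_setP Lq; apply/asboolP/limit_setP => e e0.
have [n [x qx]] := Lq _ e0; exists n, (fdc_star x).
by rewrite rho_star -corona_starB; apply: le_lt_trans (rnorm_corona_star _) qx.
Qed.
Definition limit_star (x : limit) : limit := Limit (limit_star_subproof x).

Fact limit_rho_subproof n (x : S n) : in_limit (rho x).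
Proof.
by apply/asboolP; apply: subset_closure; exists n => //; exists x.
Qed.
Definition limit_rho n (x : S n) : limit := Limit (limit_rho_subproof x).

End Transition.

Arguments trans {R S} m n x.
Arguments rho {R S} n x.
Arguments limit_rho {R S} n x.

(* Main.v *)
(* Let e_l be the image of the unit of F_l in F_oo. The defining condition says that
   e_l rho_n(x_n y_n) is close to rho_k(x) rho_k(y) for all large n and l, where
   x_n, y_n are the images of x, y in F_n; by adjunction the same holds with e_l on
   the right. For a c.p.c. map f one has |f(x)|^3 <= |x|^2 |f(1) f(x)|; applied to
   rho_l, together with |rho_{l,k}(x)| -> |rho_k(x)|, it shows that
   |r| <= limsup |e_l r| for r in the limit X. Hence the rho_n(x_n y_n) form a
   Cauchy sequence, and p \bullet q is the unique r in X such that e_l r and r e_l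
   converge to p q. Then |p \bullet q| = |p q|, and every C*-axiom of \bullet follows
   from the corresponding property of the product of F_oo by uniqueness. *)

From HB Require Import structures.
Require Import Defs.
From mathcomp Require Import all_boot all_order all_algebra.
From mathcomp Require Import all_classical all_reals all_analysis.
From mathcomp Require Import complex.
From mathcomp Require Import lra.

Import Order.TTheory GRing.Theory Num.Theory.
Import numFieldNormedType.Exports.
Local Open Scope classical_set_scope.
Local Open Scope complex_scope.
Local Open Scope ring_scope.

Import Defs.

Set Implicit Arguments.
Unset Strict Implicit.
Unset Printing Implicit Defensive.

(** * Finite-dimensional C*-algebras *)

Section RealNormTheory.
Variables (R : realType) (V : normedModType R[i]).
Implicit Types (u v : V) (c : R).

Lemma rnorm_eq0 v : rnorm v = 0 -> v = 0.
Proof. by move=> v0; apply/normr0_eq0; rewrite rnormE v0. Qed.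

Lemma rnormB u v : rnorm (u - v) = rnorm (v - u).
Proof. by rewrite -rnormN opprB. Qed.

Lemma cnorm_real c : cnorm c%:C = `|c|.
Proof.
apply: complexI; rewrite -cnormE.
by rewrite normc_def /= expr0n addr0 sqrtr_sqr.
Qed.

Lemma rnormZr c v : rnorm (c%:C *: v) = `|c| * rnorm v.
Proof. by rewrite rnormZ cnorm_real. Qed.

End RealNormTheory.

Section FdAlgebra.
Variable R : realType.

(* A copy of the carrier, so that the product of a finite-dimensional
   C*-algebra can be written in ring notation. *)
Definition fdalg (A : fdCStarAlg R) : Type := A.
HB.instance Definition _ A := NormedModule.on (fdalg A).

Section Structure.
Variable A : fdCStarAlg R.

Fact fdalg_mulDl : @left_distributive (fdalg A) (fdalg A) (@fdc_mul R A) +%R.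
Proof.
move=> x y z; have := cstar_mul_linearl (fdc_cstar A) z 1 x y.
by rewrite !scale1r.
Qed.

Fact fdalg_mulDr : @right_distributive (fdalg A) (fdalg A) (@fdc_mul R A) +%R.
Proof.
move=> z x y; have := cstar_mul_linearr (fdc_cstar A) z 1 x y.
by rewrite !scale1r.
Qed.

HB.instance Definition _ := GRing.Zmodule_isPzRing.Build (fdalg A)
  (cstar_mulA (fdc_cstar A)) (@fdc_mul1 R A) (@fdc_mulr1 R A)
  fdalg_mulDl fdalg_mulDr.

Definition adj (x : fdalg A) : fdalg A := fdc_star x.

Implicit Types (x y : fdalg A) (k : R[i]).

Lemma fdalgZl k x y : (k *: x) * y = k *: (x * y).
Proof.
have : (k *: x + 0) * y = k *: (x * y) + 0 * y.
  exact: (cstar_mul_linearl (fdc_cstar A) y k x 0).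
by rewrite mul0r !addr0.
Qed.

Lemma fdalgZr k x y : x * (k *: y) = k *: (x * y).
Proof.
have : x * (k *: y + 0) = k *: (x * y) + x * 0.
  exact: (cstar_mul_linearr (fdc_cstar A) x k y 0).
by rewrite mulr0 !addr0.
Qed.

Lemma adjK x : adj (adj x) = x.
Proof. exact: cstar_starK (fdc_cstar A) x. Qed.

Lemma adjM x y : adj (x * y) = adj y * adj x.
Proof. exact: cstar_starM (fdc_cstar A) x y. Qed.

Lemma adjD x y : adj (x + y) = adj x + adj y.
Proof. exact: cstar_starD (fdc_cstar A) x y. Qed.

Lemma adjB x y : adj (x - y) = adj x - adj y.
Proof. exact: cstar_starB (fdc_cstar A) x y. Qed.

Lemma adj0 : adj 0 = 0.
Proof. exact: cstar_star0 (fdc_cstar A). Qed.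

Lemma adj1 : adj 1 = 1.
Proof. exact: fdc_star1 A. Qed.

Lemma adjZ k x : adj (k *: x) = conjc k *: adj x.
Proof. exact: cstar_starZ (fdc_cstar A) k x. Qed.

Lemma adjZr (c : R) x : adj (c%:C *: x) = c%:C *: adj x.
Proof. by rewrite adjZ conjc_real. Qed.

Lemma rnorm_adj x : rnorm (adj x) = rnorm x.
Proof. by rewrite /rnorm (cstar_norm_star (fdc_cstar A)). Qed.

Lemma rnormM x y : rnorm (x * y) <= rnorm x * rnorm y.
Proof. by rewrite -lecR rmorphM /= -!rnormE; exact: (cstar_normM (fdc_cstar A)). Qed.

Lemma rnorm_adjM x : rnorm (adj x * x) = rnorm x ^+ 2.
Proof.
by apply: complexI; rewrite rmorphXn /= -!rnormE; exact: (cstar_norm_starM (fdc_cstar A)).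
Qed.

Lemma adjM_eq0 x : adj x * x = 0 -> x = 0.
Proof.
move=> x0; apply: rnorm_eq0; have := rnorm_adjM x; rewrite x0 rnorm0 => /esym/eqP.
by rewrite expf_eq0 => /eqP.
Qed.

(** The C*-identity gives |1| = |1|^2, so the norm is 1, or 0 in the zero algebra. *)
Lemma rnorm_one_le : rnorm (1 : fdalg A) <= 1.
Proof.
have := rnorm_adjM 1; rewrite adj1 mulr1 => h.
have := rnorm_ge0 (1 : fdalg A); nra.
Qed.

(** The d+1 powers 1, a, ..., a^d lie in the span of d vectors, so a nonzero polynomial kills a;
    over the algebraically closed field [R[i]] it splits into linear factors. *)
Lemma annihilating_roots (a : fdalg A) :
  exists s : seq R[i], \prod_(r <- s) (a - r *: (1 : fdalg A)) = 0.
Proof.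
have [d [e span]] := fdc_findim A.
have /choice[c cE] : forall j : 'I_d.+1, exists c : 'I_d -> R[i],
    a ^+ j = \sum_i c i *: (e i : fdalg A) by move=> j; exact: span.
pose M := \matrix_(j < d.+1, i < d) c j i.
have : kermx M != 0.
  by rewrite kermx_eq0 /row_free neq_ltn ltnS rank_leq_col.
case/rowV0Pn => v /sub_kermxP vM v0.
pose p := \poly_(j < d.+1) v 0 (inord j).
have ev : \sum_(j < d.+1) p`_j *: a ^+ j = 0.
  transitivity (\sum_i (v *m M) 0 i *: (e i : fdalg A)); last first.
    by rewrite vM; apply: big1 => i _; rewrite mxE scale0r.
  under eq_bigr do rewrite cE scaler_sumr.
  rewrite exchange_big; apply: eq_bigr => i _; rewrite mxE scaler_suml.
  by apply: eq_bigr => j _; rewrite coef_poly ltn_ord inord_val scalerA mxE.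
have p0 : p != 0.
  apply: contra v0 => /eqP p0; apply/eqP/rowP => j; rewrite mxE.
  have := coef_poly (d.+1) (fun j => v 0 (inord j)) j.
  by rewrite -/p p0 coef0 ltn_ord inord_val.
(* Evaluation at a turns the factor ['X - r%:P] into a - r. The size bound makes the coefficient of
   q at index n zero, so the extra term of the longer sum drops out. *)
have step (q : {poly R[i]}) n r : (size q <= n)%N ->
    \sum_(j < n.+1) (('X - r%:P) * q)`_j *: a ^+ j
    = (a - r *: (1 : fdalg A)) * \sum_(j < n) q`_j *: a ^+ j.
  move=> qn; rewrite [RHS]mulrBl fdalgZl mul1r.
  under eq_bigr do rewrite mulrBl coefB coefCM coefXM scalerBl -scalerA.
  rewrite sumrB -scaler_sumr; congr (_ - _ *: _).
    rewrite big_ord_recl /= scale0r add0r mulr_sumr; apply: eq_bigr => j _.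
    by rewrite fdalgZr -exprS.
  by rewrite big_ord_recr /= nth_default// scale0r addr0.
have [s pE] := closed_field_poly_normal p.
exists s.
have lp0 : lead_coef p != 0 by rewrite lead_coef_eq0.
have es t : \sum_(j < (size t).+1) (\prod_(z <- t) ('X - z%:P))`_j *: a ^+ j
    = \prod_(r <- t) (a - r *: (1 : fdalg A)).
  elim: t => [|r t IH]; first by rewrite big_ord1 !big_nil coef1 scale1r.
  by rewrite !big_cons step ?IH// size_prod_XsubC.
have sz : size p = (size s).+1 by rewrite pE size_scale// size_prod_XsubC.
rewrite -es; apply: (scalerI lp0); rewrite scaler0; apply: etrans ev; rewrite scaler_sumr.
have szp : (size s < d.+1)%N by rewrite -sz; exact: size_poly.
rewrite -(subnKC szp) big_split_ord /= [X in _ + X]big1 ?addr0.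
  by apply: eq_bigr => j _; rewrite scalerA [in RHS]pE coefZ.
by move=> j _; rewrite nth_default ?scale0r// sz leq_addr.
Qed.

End Structure.
End FdAlgebra.

(** * Spectral theorem and functional calculus for selfadjoint elements *)

Section Spectral.
Variables (R : realType) (A : fdCStarAlg R).
Implicit Types (a x y z : fdalg A) (c : R).

(** Letting a act on either side in z^* a z gives both conj r and r times z^* z. *)
Lemma selfadjoint_eigen_eq0 a z (r : R[i]) :
  adj a = a -> r \isn't Num.real -> a * z = r *: z -> z = 0.
Proof.
move=> aa rR az; apply: adjM_eq0.
have h : (conjc r - r) *: (adj z * z) = 0.
  by rewrite scalerBl -fdalgZl -adjZ -fdalgZr -az adjM aa mulrA subrr.
apply/eqP; move: h => /eqP; rewrite scaler_eq0 subr_eq0 => /orP[|//] /eqP rr.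
by case/negP: rR; move: rr; case: (r) => u v [] /eqP; rewrite complex_real eqNr.
Qed.

Lemma selfadjoint_sqr_eq0 a z : adj a = a -> a * (a * z) = 0 -> a * z = 0.
Proof. by move=> aa az; apply: adjM_eq0; rewrite adjM aa -mulrA az mulr0. Qed.

(** Induction on the roots: (a - r) z is a sum of eigenvectors [p l], and dividing [p l] by l - r
    for l different from r solves for z up to a remainder. For r not real the remainder is an
    eigenvector for r, hence zero; for r real it is a further eigenvector. *)
Lemma selfadjoint_eigen_sum a (s : seq R[i]) z : adj a = a ->
  (\prod_(r <- s) (a - r *: (1 : fdalg A))) * z = 0 ->
  exists (T : seq R) (p : R -> fdalg A), [/\ uniq T,
    z = \sum_(l <- T) p l & forall l, a * p l = l%:C *: p l].
Proof.
move=> aa; elim/last_ind: s z => [|s r IH] z.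
  rewrite big_nil mul1r => ->; exists [::], (fun=> 0); split => //.
    by rewrite big_nil.
  by move=> l; rewrite mulr0 scaler0.
rewrite big_rcons /= -mulrA => /IH[T [p [uT zE ap]]].
have aZ (k : R[i]) x : (a - k *: (1 : fdalg A)) * x = a * x - k *: x.
  by rewrite mulrBl fdalgZl mul1r.
pose q l := (l%:C - r)^-1 *: p l.
have aq l : a * q l = l%:C *: q l by rewrite fdalgZr ap !scalerA mulrC.
have aqr l : l%:C != r -> (a - r *: (1 : fdalg A)) * q l = p l.
  by move=> lr; rewrite aZ aq -scalerBl scalerA mulfV ?subr_eq0// scale1r.
have [/complex_realP[k rE]|rR] := boolP (r \is Num.real); last first.
  have nr l : l%:C != r.
    by apply: contra rR => /eqP <-; apply/complex_realP; exists l.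
  exists T, q; split => //; apply/eqP; rewrite -subr_eq0; apply/eqP.
  apply: (selfadjoint_eigen_eq0 aa rR); apply/eqP; rewrite -subr_eq0 -aZ.
  rewrite mulrBr zE mulr_sumr; under [X in _ - X]eq_bigr do rewrite aqr//.
  by rewrite subrr.
(* (a - k) w is the part of (a - k) z with eigenvalue k, so (a - k)^2 w = 0, and selfadjointness
   gives (a - k) w = 0. *)
pose w := z - \sum_(l <- T | l != k) q l.
have sk : adj (a - r *: (1 : fdalg A)) = a - r *: (1 : fdalg A).
  by rewrite adjB aa rE adjZr adj1.
have aw : a * w = k%:C *: w.
  apply/eqP; rewrite -subr_eq0 -aZ -rE; apply/eqP.
  apply: selfadjoint_sqr_eq0 => //.
  rewrite [X in _ * X]mulrBr zE mulr_sumr (bigID (fun l => l == k)) /=.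
  rewrite [X in _ + _ - X](_ : _ = \sum_(l <- T | l != k) p l); last first.
    by apply: eq_bigr => l lk; rewrite aqr// rE (inj_eq (@complexI R)).
  rewrite addrK mulr_sumr; apply: big1 => l /eqP ->.
  by rewrite aZ ap rE subrr.
exists (k :: [seq l <- T | l != k]), (fun l => if l == k then w else q l); split.
- by rewrite cons_uniq filter_uniq// mem_filter eqxx.
- rewrite big_cons eqxx big_filter; apply/eqP; rewrite -subr_eq; apply/eqP.
  by congr (_ - _); apply: eq_bigr => l /negbTE ->.
- by move=> l; case: eqP => [->//|_].
Qed.

(** Orthogonal projections indexed by eigenvalues; [p] matters only on [T], where it is nonzero so
    that each point of [T] is a genuine eigenvalue. *)
Definition resolution (T : seq R) (p : R -> fdalg A) := [/\ uniq T,
  {in T, forall l, adj (p l) = p l /\ p l != 0},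
  {in T &, forall l m, p l * p m = if l == m then p l else 0} &
  \sum_(l <- T) p l = 1].

Definition fcalc (T : seq R) (p : R -> fdalg A) (f : R -> R) : fdalg A :=
  \sum_(l <- T) (f l)%:C *: p l.

(** The unit is split into eigenvectors [p l]. Distinct real eigenvalues make them orthogonal, so
    multiplying [adj (p l)] by 1 leaves [adj (p l) * p l]: each [p l] is a projection. The zero ones
    are discarded. *)
Lemma spectral_decomposition a : adj a = a ->
  exists T p, resolution T p /\ a = fcalc T p id.
Proof.
move=> aa; have [s sa] := annihilating_roots a.
have [|T [p [uT oneE ap]]] := @selfadjoint_eigen_sum a s 1 aa.
  by rewrite mulr1.
have pp l m : l != m -> adj (p l) * p m = 0.
  move=> lm; apply/eqP; have : (m%:C - l%:C) *: (adj (p l) * p m) == 0.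
    rewrite scalerBl -[m%:C *: _]fdalgZr -ap -[l%:C *: _]fdalgZl -adjZr -ap.
    by rewrite adjM aa mulrA subrr.
  by rewrite scaler_eq0 subr_eq0 (inj_eq (@complexI R)) eq_sym (negbTE lm).
have adjp l : l \in T -> adj (p l) = adj (p l) * p l.
  move=> lT; rewrite -[LHS]mulr1 oneE mulr_sumr (bigD1_seq l)//= big1 ?addr0//.
  by move=> m; rewrite eq_sym => /pp.
have sp l : l \in T -> adj (p l) = p l.
  by move=> /adjp h; rewrite -[RHS]adjK h adjM adjK.
exists [seq l <- T | p l != 0], p.
have sumT (f : R -> R[i]) :
    \sum_(l <- [seq l <- T | p l != 0]) f l *: p l = \sum_(l <- T) f l *: p l.
  rewrite big_filter [RHS](bigID (fun l => p l != 0)) /= [X in _ + X]big1 ?addr0//.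
  by move=> l /negPn/eqP ->; rewrite scaler0.
split; first split.
- by rewrite filter_uniq.
- by move=> l; rewrite mem_filter => /andP[p0 lT]; rewrite sp.
- move=> l m; rewrite !mem_filter => /andP[_ lT] /andP[_ mT].
  case: eqP => [<-|/eqP lm]; first by rewrite -[X in X * _]sp// -adjp// sp.
  by rewrite -[X in X * _]sp// pp.
- rewrite oneE; have := sumT (fun=> 1).
  by under eq_bigr do rewrite scale1r; under [in RHS]eq_bigr do rewrite scale1r.
- rewrite /fcalc sumT -[LHS]mulr1 oneE mulr_sumr.
  by apply: eq_bigr => l _; exact: ap.
Qed.

Section FunctionalCalculus.
Variables (T : seq R) (p : R -> fdalg A).
Hypothesis res : resolution T p.
Implicit Types f g : R -> R.

Lemma fcalc_proj f l : l \in T -> fcalc T p f * p l = (f l)%:C *: p l.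
Proof.
case: res => uT _ pp _ lT; rewrite mulr_suml (bigD1_seq l)//= big_seq_cond big1.
  by rewrite addr0 fdalgZl pp// eqxx.
by move=> m /andP[mT ml]; rewrite fdalgZl pp// (negbTE ml) scaler0.
Qed.

Lemma fcalcM f g : fcalc T p f * fcalc T p g = fcalc T p (fun l => f l * g l).
Proof.
rewrite [fcalc T p g]/fcalc mulr_sumr; apply: eq_big_seq => l lT.
by rewrite fdalgZr fcalc_proj// scalerA mulrC rmorphM.
Qed.

Lemma eq_in_fcalc f g : {in T, f =1 g} -> fcalc T p f = fcalc T p g.
Proof. by move=> fg; apply: eq_big_seq => l lT; rewrite fg. Qed.

Lemma fcalc_cst c : fcalc T p (fun=> c) = c%:C *: (1 : fdalg A).
Proof. by case: res => _ _ _ <-; rewrite scaler_sumr. Qed.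

Lemma fcalcD f g : fcalc T p f + fcalc T p g = fcalc T p (fun l => f l + g l).
Proof. by rewrite -big_split; apply: eq_bigr => l _; rewrite rmorphD scalerDl. Qed.

Lemma fcalcB f g : fcalc T p f - fcalc T p g = fcalc T p (fun l => f l - g l).
Proof. by rewrite -sumrB; apply: eq_bigr => l _; rewrite rmorphB scalerBl. Qed.

Lemma adj_fcalc f : adj (fcalc T p f) = fcalc T p f.
Proof.
rewrite /fcalc (big_morph (@adj R A) (@adjD R A) (@adj0 R A)).
by case: res => _ h _ _; apply: eq_big_seq => l /h[h1 _]; rewrite adjZr h1.
Qed.

(* For b the element at hand and c = sqrt (M^2 - b^2), the element b + ic
   satisfies (b + ic)^* (b + ic) = M^2, and 2b = (b + ic) + (b + ic)^*. *)
Lemma rnorm_fcalc_le f M : {in T, forall l, `|f l| <= M} -> 0 <= M ->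
  rnorm (fcalc T p f) <= M.
Proof.
move=> fM M0; set b := fcalc T p f.
pose c := fcalc T p (fun l => Num.sqrt (M ^+ 2 - f l ^+ 2)).
pose u := b + 'i%C *: c.
have au : adj u = b - 'i%C *: c.
  rewrite adjD adjZ !adj_fcalc -scaleNr; congr (_ + _ *: _).
  by apply/eqP; rewrite eq_complex /= oppr0 !eqxx.
have bc : b * c = c * b.
  by rewrite !fcalcM; apply: eq_in_fcalc => l _; rewrite mulrC.
have uu : adj u * u = (M ^+ 2)%:C *: (1 : fdalg A).
  rewrite au mulrDr !mulrBl !fdalgZl !fdalgZr scalerA.
  rewrite [_ * _ : R[i]](sqr_i R) scaleN1r bc.
  rewrite opprK addrA subrK.
  have -> : b * b + c * c = fcalc T p (fun=> M ^+ 2).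
    rewrite !fcalcM fcalcD; apply: eq_in_fcalc => l lT.
    rewrite -!expr2 sqr_sqrtr ?subrKC// subr_ge0.
    by rewrite -[f l ^+ 2]real_normK ?num_real// lerXn2r ?nnegrE// fM.
  by rewrite fcalc_cst.
have uM : rnorm u <= M.
  have : rnorm u ^+ 2 <= M ^+ 2.
    rewrite -rnorm_adjM uu rnormZr ger0_norm ?sqr_ge0//.
    by rewrite ler_piMr ?sqr_ge0// rnorm_one_le.
  by rewrite ler_pXn2r ?nnegrE ?rnorm_ge0.
have : rnorm (u + adj u) <= M + M.
  by apply: le_trans (ler_rnormD _ _) _; rewrite rnorm_adj lerD.
rewrite au addrACA subrr addr0 -mulr2n -scaler_nat -[2%:R]/(2%:R : R[i]).
have -> : 2%:R = (2 : R)%:C by rewrite rmorph_nat.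
rewrite rnormZr ger0_norm//; lra.
Qed.

(** [p l] is a nonzero eigenvector of [fcalc T p f] for [f l]. *)
Lemma rnorm_fcalc_ge f l : l \in T -> `|f l| <= rnorm (fcalc T p f).
Proof.
move=> lT; case: (res) => _ /(_ _ lT)[_ pl0] _ _.
have pl : 0 < rnorm (p l).
  by rewrite lt_neqAle rnorm_ge0 andbT eq_sym; apply: contra pl0 => /eqP/rnorm_eq0 ->.
by rewrite -(ler_pM2r pl) -rnormZr -fcalc_proj//; exact: rnormM.
Qed.

End FunctionalCalculus.

(** Every eigenvalue l of a satisfies l <= |a| <= c, so the square root of c - l is available. *)
Lemma selfadjoint_sub_square a c : adj a = a -> rnorm a <= c ->
  exists x, adj x * x = c%:C *: (1 : fdalg A) - a.
Proof.
move=> /spectral_decomposition[T [p [res aE]]] ac.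
exists (fcalc T p (fun l => Num.sqrt (c - l))).
rewrite adj_fcalc// fcalcM// -(fcalc_cst res) [in RHS]aE fcalcB.
apply: eq_in_fcalc => l lT; rewrite -expr2 sqr_sqrtr// subr_ge0.
apply: le_trans (ler_norm _) (le_trans _ ac).
by rewrite aE; exact: (rnorm_fcalc_ge res id lT).
Qed.

End Spectral.

(** * Positive elements and norm estimates from order *)

Section Positivity.
Variables (R : realType) (A : fdCStarAlg R).
Implicit Types (a b x y z : fdalg A) (c : R).

(* For a selfadjoint this says that its spectrum is nonnegative; stated with the
   norm, it is visibly stable under sums. *)
Definition pos a := exists t : R, rnorm (t%:C *: (1 : fdalg A) - a) <= t.

Lemma posD a b : pos a -> pos b -> pos (a + b).
Proof.
move=> [s sa] [t tb]; exists (s + t).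
rewrite rmorphD scalerDl opprD addrACA.
by apply: le_trans (ler_rnormD _ _) _; exact: lerD.
Qed.

Lemma posZ c a : 0 <= c -> pos a -> pos (c%:C *: a).
Proof.
move=> c0 [t ta]; exists (c * t).
by rewrite rmorphM -scalerA -scalerBr rnormZr ger0_norm// ler_wpM2l.
Qed.

Lemma pos_rnormB a : pos ((rnorm a)%:C *: (1 : fdalg A) - a).
Proof. by exists (rnorm a); rewrite subKr. Qed.

Lemma fcalc_pos T p f : resolution T p -> {in T, forall l, 0 <= f l} ->
  pos (fcalc T p f : fdalg A).
Proof.
move=> res f0; exists (rnorm (fcalc T p f)).
rewrite -(fcalc_cst res) fcalcB; apply: rnorm_fcalc_le => // [l lT|].
  have fl := rnorm_fcalc_ge res f lT.
  have := f0 _ lT; rewrite ger0_norm in fl; last exact: f0.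
  by move=> fl0; rewrite ger0_norm ?subr_ge0// gerBl.
exact: rnorm_ge0.
Qed.

Lemma pos_fcalc T p f : resolution T p -> pos (fcalc T p f : fdalg A) ->
  {in T, forall l, 0 <= f l}.
Proof.
move=> res [t]; rewrite -(fcalc_cst res) fcalcB => ft l lT.
have := le_trans (rnorm_fcalc_ge res _ lT) ft.
by rewrite ler_distl lerDr => /andP[].
Qed.

Lemma pos_sqr x : adj x = x -> pos (x * x).
Proof.
move=> /spectral_decomposition[T [p [res ->]]].
by rewrite fcalcM//; apply: fcalc_pos => // l _; rewrite -expr2 sqr_ge0.
Qed.

Lemma sqr_polarization x y :
  (x + y) * (x + y) - (x - y) * (x - y) = (x * y + y * x) *+ 2.
Proof.
rewrite !mulrBl !mulrDl !mulrBr !mulrDr !opprB.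
by rewrite (AC ((2*2)*(2*2)) ((1*8)*(4*6)*((2*3)*(7*5))))/= !subrr !add0r mulr2n.
Qed.

(* The Kelley-Vaught argument: if x^* x had an eigenvalue l < 0, with projection
   p l, then d = x p l would satisfy d^* d = l p l and d d^* = r with
   r^2 = l r, whereas d^* d + d d^* is a sum of squares of selfadjoints. *)
Lemma pos_adjM x : pos (adj x * x).
Proof.
have xx : adj (adj x * x) = adj x * x by rewrite adjM adjK.
have [T [p [res xE]]] := spectral_decomposition xx.
rewrite xE; apply: fcalc_pos => // l lT; rewrite leNgt; apply/negP => l0.
have [uT /(_ _ lT)[sp pl0] /(_ _ _ lT lT)] := res; rewrite eqxx => pp _.
pose d := x * p l; pose r := d * adj d.
have dd : adj d * d = l%:C *: p l.
  by rewrite adjM sp -mulrA [adj x * _]mulrA xE fcalc_proj// fdalgZr pp.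
have rr : r * r = l%:C *: r.
  have dp : d * p l = d by rewrite -mulrA pp.
  by rewrite /r mulrA -[d * _ * d]mulrA dd fdalgZr fdalgZl dp.
have sr : adj r = r by rewrite adjM adjK.
pose u := d + adj d; pose v := 'i%C *: (d - adj d).
have su : adj u = u by rewrite adjD adjK addrC.
have sv : adj v = v.
  rewrite adjZ adjB adjK -opprB scalerN -scaleNr; congr (_ *: _).
  by apply/eqP; rewrite eq_complex /= oppr0 opprK !eqxx.
have uv : u * u + v * v = 2%:C *: (l%:C *: p l) + 2%:C *: r.
  rewrite fdalgZl fdalgZr scalerA [_ * _ : R[i]](sqr_i R) scaleN1r -dd.
  by rewrite sqr_polarization addrC mulr2n !rmorphD !scalerDl !scale1r addrACA.
(* Since r^2 = l r, the added positive term equals -2r and cancels the 2r in u^2 + v^2. What remains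
   is 2l times [p l], with the negative eigenvalue 2l. *)
have : pos (u * u + v * v + (2 / - l)%:C *: (r * r)).
  apply: posD; first by apply: posD; exact: pos_sqr.
  by apply: posZ; [rewrite divr_ge0// oppr_ge0 ltW|exact: pos_sqr].
have -> : u * u + v * v + (2 / - l)%:C *: (r * r)
    = fcalc T p (fun m => if m == l then 2 * l else 0).
  have -> : (2 / - l)%:C *: (r * r) = - (2%:C *: r).
    rewrite rr scalerA -rmorphM invrN mulrN mulNr -mulrA mulVf ?lt_eqF// mulr1.
    by rewrite rmorphN scaleNr.
  rewrite uv addrK /fcalc (bigD1_seq l)//= eqxx big1 => [|m ml].
    by rewrite addr0 scalerA rmorphM.
  by rewrite (negbTE ml) scale0r.
move=> /(pos_fcalc res)/(_ _ lT); rewrite eqxx pmulr_rge0//.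
by rewrite leNgt l0.
Qed.

(** Adding |b| 1 - b >= 0 and b - a >= 0 puts the spectrum of a in [0, |b|]. *)
Lemma pos_rnorm_le a b : adj a = a -> pos a -> pos (b - a) ->
  rnorm a <= rnorm b.
Proof.
move=> /spectral_decomposition[T [p [res aE]]] a0 ba0.
have := posD (pos_rnormB b) ba0; rewrite addrA subrK {1}aE -(fcalc_cst res) fcalcB.
move=> /(pos_fcalc res) => h; rewrite [X in rnorm X]aE.
apply: rnorm_fcalc_le => // [l lT|]; last exact: rnorm_ge0.
rewrite ger0_norm; first by rewrite -subr_ge0; exact: h.
by move: a0; rewrite {1}aE => /(pos_fcalc res)/(_ _ lT).
Qed.

End Positivity.

(* With h = f 1, y = f x and |x| <= 1, complete positivity on 2 x 2 matrices gives
   y y^* <= h, hence (y^* y)^2 <= y^* h y. *)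
Lemma completely_positive_lower_bound (R : realType) (A B : fdCStarAlg R)
    (f : A -> B) (x : A) :
  completely_positive f -> (forall (c : R) z, f (c%:C *: z) = c%:C *: f z) ->
  (forall z, rnorm (f z) <= rnorm z) ->
  rnorm (f x) ^+ 3 <= rnorm x ^+ 2 * rnorm (fdc_mul (f (fdc_one A)) (f x)).
Proof.
move=> fcp fZ fle; set t := rnorm x ^+ 2.
pose X : fdalg A := x; pose h : fdalg B := f (fdc_one A); pose y : fdalg B := f x.
change (rnorm y ^+ 3 <= t * rnorm (h * y)).
have [c cc] : exists c, adj c * c = t%:C *: (1 : fdalg A) - X * adj X.
  apply: selfadjoint_sub_square; first by rewrite adjM adjK.
  by rewrite -[X in X * adj _]adjK rnorm_adjM rnorm_adj.
have [g gg] : exists g, adj g * g = 1%:C *: (1 : fdalg B) - h.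
  apply: selfadjoint_sub_square.
    by rewrite -[LHS](completely_positive_star _ fcp) fdc_star1.
  exact: le_trans (fle _) (rnorm_one_le A).
rewrite scale1r in gg.
pose o1 : 'I_2 := lift ord0 ord0.
(* With rows ([adj X], 1) and (c, 0), and c^* c = t - x x^*, the positive matrix b^* b is [[t, x],
   [x^*, 1]], which f maps to [[t h, y], [y^*, h]]. *)
pose b : 'M[A]_2 := \matrix_(i, j)
  if i == ord0 then (if j == ord0 then adj X else 1 : fdalg A)
  else (if j == ord0 then c else 0).
pose a : 'M[A]_2 := \matrix_(i, j) \sum_k fdc_mul (fdc_star (b k i)) (b k j).
have aE i j : a i j = adj (b ord0 i : fdalg A) * (b ord0 j : fdalg A)
    + adj (b o1 i : fdalg A) * (b o1 j : fdalg A).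
  by rewrite mxE big_ord_recl big_ord1.
have [v vE] := fcp _ a (ex_intro _ b erefl).
pose w k j : fdalg B := v k j.
have fa i j : f (a i j) = adj (w ord0 i) * w ord0 j + adj (w o1 i) * w o1 j.
  have /matrixP/(_ i j) := vE.
  by rewrite mxE => ->; rewrite mxE big_ord_recl big_ord1.
have h00 : t%:C *: h = adj (w ord0 ord0) * w ord0 ord0 + adj (w o1 ord0) * w o1 ord0.
  by rewrite -fa aE !mxE /= adjK cc subrKC fZ.
have h01 : y = adj (w ord0 ord0) * w ord0 o1 + adj (w o1 ord0) * w o1 o1.
  by rewrite -fa aE !mxE /= adjK mulr1 mulr0 addr0.
have h11 : h = adj (w ord0 o1) * w ord0 o1 + adj (w o1 o1) * w o1 o1.
  by rewrite -fa aE !mxE /= adj1 mulr1 mulr0 addr0.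
(* This compresses the image matrix by the column with entries 1 and -y^*, which yields t h - 2 y
   y^* + y h y^*. Adding y (1 - h) y^*, a square through g, leaves t h - y y^*. *)
pose s k := w k ord0 - w k o1 * adj y.
have key : t%:C *: h - y * adj y =
    adj (s ord0) * s ord0 + adj (s o1) * s o1 + adj (g * adj y) * (g * adj y).
  have subACA (z1 z2 z3 z4 : fdalg B) : (z1 - z2) + (z3 - z4) = (z1 + z3) - (z2 + z4).
    by rewrite addrACA opprD.
  have ss k : adj (s k) * s k =
      (adj (w k ord0) * w k ord0 - adj (w k ord0) * w k o1 * adj y)
      - (y * (adj (w k o1) * w k ord0) - y * (adj (w k o1) * w k o1) * adj y).
    by rewrite adjB adjM adjK mulrBl !mulrBr !mulrA.
  have yE : adj y = adj (w ord0 o1) * w ord0 ord0 + adj (w o1 o1) * w o1 ord0.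
    by rewrite h01 adjD !adjM !adjK.
  rewrite !ss !subACA -!mulrDl -!mulrDr -h00 -h01 -yE -h11.
  rewrite adjM adjK mulrA -[y * _ * g]mulrA gg mulrBr mulrBl mulr1.
  by rewrite subrK.
have [->|y0] := eqVneq (rnorm y) 0.
  by rewrite expr0n mulr_ge0 ?sqr_ge0 ?rnorm_ge0.
have {}y0 : 0 < rnorm y by rewrite lt_neqAle eq_sym y0 rnorm_ge0.
(* After multiplication by |y| the left side is |y|^4, the norm of y^* y y^* y, which is dominated
   by t y^* h y. *)
rewrite -(ler_pM2l y0) -exprS.
have sq : adj (adj y * y) = adj y * y by rewrite adjM adjK.
have yE : adj y * (y * adj y) * y = adj (adj y * y) * (adj y * y).
  by rewrite sq !mulrA.
have -> : rnorm y ^+ 4 = rnorm (adj y * (y * adj y) * y).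
  by rewrite yE !rnorm_adjM -exprM.
apply: (@le_trans _ _ (rnorm (t%:C *: (adj y * (h * y))))).
  apply: pos_rnorm_le.
  - by rewrite !adjM !adjK !mulrA.
  - by rewrite yE; exact: pos_adjM.
  - have cE : t%:C *: (adj y * (h * y)) - adj y * (y * adj y) * y =
        adj y * (t%:C *: h - y * adj y) * y.
      by rewrite mulrBr mulrBl fdalgZr fdalgZl mulrA.
    have expand z1 z2 z3 : adj y * (z1 + z2 + z3) * y =
        adj y * z1 * y + adj y * z2 * y + adj y * z3 * y.
      by rewrite !mulrDr !mulrDl.
    rewrite cE key expand.
    have conj z : pos (adj y * (adj z * z) * y).
      by rewrite mulrA -adjM -mulrA; exact: pos_adjM.
    by apply: posD; [apply: posD|]; exact: conj.
rewrite rnormZr ger0_norm ?sqr_ge0// mulrCA ler_wpM2l ?sqr_ge0//.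
by have := rnormM (adj y) (h * y); rewrite rnorm_adj.
Qed.

(** * The corona *)

Section CoronaNorm.
Variables (R : realType) (F : nat -> normedModType R[i]).
Implicit Types x y : bseq F.

(** Together with [corona_norm_le_near], this makes the quotient norm computable as the limit
    superior of the norms of the entries. *)
Lemma corona_norm_lt_near x c : rnorm (cls x) < c ->
  \forall n \near \oo, rnorm (x n) < c.
Proof.
rewrite rnorm_corona => /corona_norm_lt[y /clsP/is_nullP xy yc].
have cy : 0 < c - sup_norm y by rewrite subr_gt0.
have := xy _ cy; apply: filterS => n h.
have -> : x n = (x - y) n + y n by rewrite /= subrK.
apply: le_lt_trans (ler_rnormD _ _) _; rewrite -[ltRHS](subrK (sup_norm y)).
by rewrite ltr_leD// sup_norm_ub.
Qed.

(** Replacing the finitely many entries that violate the bound by 0 does not change the class. *)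
Lemma corona_norm_le_near x c : (\forall n \near \oo, rnorm (x n) <= c) ->
  rnorm (cls x) <= c.
Proof.
move=> [N _ xc].
have c0 : 0 <= c by apply: le_trans (rnorm_ge0 (x N)) (xc _ _) => /=.
pose y0 n := if (n < N)%N then 0 else x n.
have y0c n : rnorm (y0 n) <= c.
  by rewrite /y0; case: ltnP => [_|/xc//]; rewrite rnorm0.
have y0b : exists M : R, forall n, `|y0 n| <= M%:C.
  by exists c => n; rewrite rnormE lecR.
have -> : cls x = cls (BSeq y0b).
  apply/clsP/is_nullP => e e0; near=> n.
  have Nn : (N <= n)%N by near: n; exact: nbhs_infty_ge.
  by rewrite /= /y0 ltnNge Nn subrr rnorm0.
rewrite rnorm_corona; apply: le_trans (corona_norm_le _) _.
exact: sup_norm_le.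
Unshelve. all: by end_near. Qed.

(* A diagonal sequence of representatives: at the index m, use the last i <= m for
   which the first i representatives satisfy the Cauchy estimate at m. *)
Lemma corona_complete (q : nat -> corona F) (e : nat -> R) :
  (forall i j, (i <= j)%N -> rnorm (q i - q j) < e i) ->
  exists p, forall i, rnorm (p - q i) <= e i.
Proof.
move=> qe; have /choice[y qy] : forall i, exists x, q i = cls x.
  by move=> i; exact: cls_repr.
pose C n m := forall i j, (i <= j <= n)%N -> rnorm (y i m - y j m) <= e i.
have C0 m : C 0 m.
  move=> i j; rewrite leqn0 => /andP[+ /eqP j0]; rewrite j0 leqn0 => /eqP ->.
  rewrite subrr rnorm0; apply/ltW/(le_lt_trans _ (qe 0 0 (leqnn _))).
  exact: rnorm_ge0.
have Cnear n : \forall m \near \oo, C n m.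
  have h i j : (i <= j)%N -> \forall m \near \oo, rnorm (y i m - y j m) < e i.
    by move=> ij; have := qe _ _ ij; rewrite !qy -clsB => /corona_norm_lt_near.
  elim: n => [|n IH]; first by near=> m; exact: C0.
  have hn : \forall m \near \oo, forall i : 'I_n.+2, rnorm (y i m - y n.+1 m) < e i.
    by apply: filter_forall => i; apply: h; rewrite -ltnS.
  near=> m.
  have hm : forall i : 'I_n.+2, rnorm (y i m - y n.+1 m) < e i by near: m.
  have Cm : C n m by near: m; exact: IH.
  move=> i j /andP[ij]; rewrite leq_eqVlt => /predU1P[jn|jn].
    have im : (i < n.+2)%N by rewrite ltnS -jn.
    by rewrite jn ltW//; exact: (hm (Ordinal im)).
  by apply: Cm; rewrite ij.
(* The restriction to n <= m guarantees a maximum even if [C n m] holds for every n. *)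
have /choice[nu nuP] : forall m, exists n, C n m /\
    forall k, (k <= m)%N -> C k m -> (k <= n)%N.
  move=> m; pose P n := `[< C n m >] && (n <= m)%N.
  have exP : exists n, P n by exists 0%N; rewrite /P leq0n andbT; apply/asboolP.
  have ubP n : P n -> (n <= m)%N by move=> /andP[].
  case: (ex_maxnP exP ubP) => n /andP[/asboolP Cn _] nmax; exists n; split=> // k km Ck.
  by apply: nmax; rewrite /P km andbT; apply/asboolP.
(* Comparison with the representative of index 0 bounds the diagonal sequence. *)
have y0e m : rnorm (y 0%N m - y (nu m) m) <= e 0%N.
  by have [+ _] := nuP m; apply; rewrite leq0n /=.
have [M yM] := bseq_bounded (y 0%N).
have yb : exists M : R, forall m, `|y (nu m) m| <= M%:C.
  exists (e 0%N + M) => m; rewrite -[y (nu m) m](subrK (y 0%N m)).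
  rewrite rnormE lecR; apply: le_trans (ler_rnormD _ _) _; apply: lerD.
    by rewrite -rnormN opprB.
  by rewrite -lecR -rnormE.
exists (cls (BSeq yb)) => i; rewrite qy -clsB; apply: corona_norm_le_near.
near=> m; rewrite /= -rnormN opprB; have [+ h] := nuP m; apply.
rewrite leqnn andbT; apply: h; near: m; [exact: nbhs_infty_ge|exact: Cnear].
Unshelve. all: by end_near. Qed.

End CoronaNorm.

(** * Product and C*-identities of the corona *)

Section CoronaAlgebra.
Variables (R : realType) (S : cpc_system R).
Local Notation bseqS := (bseq (fun n => fdc_sort (S n))).
Local Notation C := (sys_corona S).
Implicit Types (x y : bseqS) (p q r : C) (k : R[i]).

Fact bseq_mul_subproof x y : exists M : R, forall n, `|fdc_mul (x n) (y n)| <= M%:C.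
Proof.
have [M xM] := bseq_bounded x; have [N yN] := bseq_bounded y.
exists (M * N) => n; rewrite rmorphM.
by apply: le_trans (cstar_normM (fdc_cstar _) _ _) _; rewrite ler_pM.
Qed.
Definition bseq_mul x y : bseqS := BSeq (bseq_mul_subproof x y).

Fact bseq_one_subproof : exists M : R, forall n, `|fdc_one (S n)| <= M%:C.
Proof. by exists 1 => n; rewrite rnormE lecR; exact: (rnorm_one_le (S n)). Qed.
Definition bseq_one : bseqS := BSeq bseq_one_subproof.

Definition corona_mul p q : C := cls (bseq_mul (repr p) (repr q)).

Lemma is_null_mul x y : is_null x || is_null y -> is_null (bseq_mul x y).
Proof.
have [M xM] := bseq_bounded x; have [N yN] := bseq_bounded y.
have le n (u v : S n) : rnorm (fdc_mul u v) <= rnorm u * rnorm v.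
  exact: (rnormM (u : fdalg (S n)) v).
have {}xM n : rnorm (x n) <= M by rewrite -lecR -rnormE.
have {}yN n : rnorm (y n) <= N by rewrite -lecR -rnormE.
have M0 : 0 < M + 1 by rewrite ltr_wpDl// (le_trans (rnorm_ge0 (x 0%N))).
have N0 : 0 < N + 1 by rewrite ltr_wpDl// (le_trans (rnorm_ge0 (y 0%N))).
case/orP => /is_nullP h; apply/is_nullP => e e0.
- have := h _ (divr_gt0 e0 N0); apply: filterS => n; rewrite ltr_pdivlMr// => hn.
  apply: le_lt_trans (le _ _ _) (le_lt_trans _ hn).
  by rewrite ler_wpM2l ?rnorm_ge0// (le_trans (yN n))// lerDl.
- have := h _ (divr_gt0 e0 M0); apply: filterS => n; rewrite ltr_pdivlMr// => hn.
  apply: le_lt_trans (le _ _ _) (le_lt_trans _ hn).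
  by rewrite mulrC ler_wpM2l ?rnorm_ge0// (le_trans (xM n))// lerDl.
Qed.

Lemma cls_mul x y : cls (bseq_mul x y) = corona_mul (cls x) (cls y).
Proof.
have xr : cls x = cls (repr (cls x)) by rewrite [RHS]reprK.
have yr : cls y = cls (repr (cls y)) by rewrite [RHS]reprK.
rewrite /corona_mul; set x' := repr _ in xr *; set y' := repr _ in yr *.
transitivity (cls (bseq_mul x' y)).
  apply/clsP; have -> : bseq_mul x y - bseq_mul x' y = bseq_mul (x - x') y.
    by apply/bseqP => n; exact/esym/(@mulrBl (fdalg (S n))).
  by apply: is_null_mul; apply/orP; left; apply/clsP.
apply/clsP; have -> : bseq_mul x' y - bseq_mul x' y' = bseq_mul x' (y - y').
  by apply/bseqP => n; exact/esym/(@mulrBr (fdalg (S n))).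
by apply: is_null_mul; apply/orP; right; apply/clsP.
Qed.

Fact corona_mulA : associative corona_mul.
Proof.
move=> p q r; have [x ->] := cls_repr p; have [y ->] := cls_repr q.
have [z ->] := cls_repr r; rewrite -!cls_mul; congr cls; apply/bseqP => n.
exact: (@mulrA (fdalg (S n))).
Qed.
Fact corona_mul1 : left_id (cls bseq_one) corona_mul.
Proof.
move=> p; have [x ->] := cls_repr p; rewrite -!cls_mul; congr cls; apply/bseqP => n.
exact: (@mul1r (fdalg (S n))).
Qed.
Fact corona_mulr1 : right_id (cls bseq_one) corona_mul.
Proof.
move=> p; have [x ->] := cls_repr p; rewrite -!cls_mul; congr cls; apply/bseqP => n.
exact: (@mulr1 (fdalg (S n))).
Qed.
Fact corona_mulDl : left_distributive corona_mul +%R.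
Proof.
move=> p q r; have [x ->] := cls_repr p; have [y ->] := cls_repr q.
have [z ->] := cls_repr r; rewrite -clsD -!cls_mul -clsD; congr cls.
by apply/bseqP => n; exact: (@mulrDl (fdalg (S n))).
Qed.
Fact corona_mulDr : right_distributive corona_mul +%R.
Proof.
move=> p q r; have [x ->] := cls_repr p; have [y ->] := cls_repr q.
have [z ->] := cls_repr r; rewrite -clsD -!cls_mul -clsD; congr cls.
by apply/bseqP => n; exact: (@mulrDr (fdalg (S n))).
Qed.
HB.instance Definition _ := GRing.Zmodule_isPzRing.Build (sys_corona S)
  corona_mulA corona_mul1 corona_mulr1 corona_mulDl corona_mulDr.

Lemma clsM x y : cls (bseq_mul x y) = (cls x : C) * cls y.
Proof. exact: cls_mul. Qed.

Lemma coronaZl k p q : (k *: p) * q = k *: (p * q).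
Proof.
have [x ->] := cls_repr p; have [y ->] := cls_repr q.
rewrite -clsM -[k *: (cls x : C)]clsZ -[k *: (cls _ : C)]clsZ -clsM; congr cls.
by apply/bseqP => n; exact: (@fdalgZl _ (S n)).
Qed.

Lemma coronaZr k p q : p * (k *: q) = k *: (p * q).
Proof.
have [x ->] := cls_repr p; have [y ->] := cls_repr q.
rewrite -clsM -[k *: (cls y : C)]clsZ -[k *: (cls _ : C)]clsZ -clsM; congr cls.
by apply/bseqP => n; exact: (@fdalgZr _ (S n)).
Qed.

Lemma corona_starK : involutive (@corona_star R S).
Proof.
move=> p; have [x ->] := cls_repr p; rewrite -!cls_star; congr cls.
by apply/bseqP => n; exact: (@adjK _ (S n)).
Qed.

Lemma corona_starM p q : corona_star (p * q) = corona_star q * corona_star p.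
Proof.
have [x ->] := cls_repr p; have [y ->] := cls_repr q.
rewrite -clsM -!cls_star -clsM; congr cls.
by apply/bseqP => n; exact: (@adjM _ (S n)).
Qed.

Lemma corona_star_semilinear k p q :
  corona_star (k *: p + q) = conjc k *: corona_star p + corona_star q.
Proof.
have [x ->] := cls_repr p; have [y ->] := cls_repr q.
rewrite -[k *: (cls x : C)]clsZ -clsD -!cls_star -[_ *: (cls _ : C)]clsZ -clsD.
by congr cls; apply/bseqP => n /=; rewrite (cstar_star_semilinear (fdc_cstar _)).
Qed.

Lemma rnorm_star p : rnorm (corona_star p) = rnorm p.
Proof.
apply/eqP; rewrite eq_le rnorm_corona_star /=.
by rewrite -{1}[p]corona_starK rnorm_corona_star.
Qed.

Lemma rnorm_coronaM p q : rnorm (p * q) <= rnorm p * rnorm q.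
Proof.
apply/ler_addgt0Pr => e e0.
(* With d <= 1, the product (|p| + d)(|q| + d) exceeds |p| |q| by at most d (|p| + |q| + 1) <= e. *)
pose d := Num.min 1 (e / (rnorm p + rnorm q + 1)).
have s0 : 0 < rnorm p + rnorm q + 1 by rewrite ltr_wpDl// addr_ge0 ?rnorm_ge0.
have d0 : 0 < d by rewrite lt_min ltr01 divr_gt0.
have d1 : d <= 1 by rewrite ge_min lexx.
have de : d * (rnorm p + rnorm q + 1) <= e.
  by rewrite -ler_pdivlMr// ge_min lexx orbT.
have pd : rnorm p < rnorm p + d by rewrite ltrDl.
have qd : rnorm q < rnorm q + d by rewrite ltrDl.
have [p0 q0] : 0 <= rnorm p /\ 0 <= rnorm q by rewrite !rnorm_ge0.
apply: (@le_trans _ _ ((rnorm p + d) * (rnorm q + d))); last first.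
  by clear -d0 d1 de p0 q0; move: (rnorm p) (rnorm q) de p0 q0 => u v *; nra.
have [x pE] := cls_repr p; have [y qE] := cls_repr q.
rewrite {1}pE {1}qE -clsM; apply: corona_norm_le_near.
near=> n; apply: le_trans (rnormM (x n : fdalg (S n)) (y n)) _.
apply: ler_pM; rewrite ?rnorm_ge0//; apply: ltW; near: n.
  by apply: corona_norm_lt_near; rewrite -pE.
by apply: corona_norm_lt_near; rewrite -qE.
Unshelve. all: by end_near. Qed.

Lemma rnorm_corona_starM p : rnorm (corona_star p * p) = rnorm p ^+ 2.
Proof.
apply/eqP; rewrite eq_le; apply/andP; split.
  by apply: le_trans (rnorm_coronaM _ _) _; rewrite rnorm_star expr2.
have [x ->] := cls_repr p; rewrite -cls_star -clsM.
apply/ler_addgt0Pr => e e0; set c := rnorm _ + e.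
have c0 : 0 <= c by rewrite addr_ge0 ?rnorm_ge0// ltW.
rewrite -[leRHS]sqr_sqrtr// ler_pXn2r ?nnegrE ?rnorm_ge0 ?sqrtr_ge0//.
apply: corona_norm_le_near.
have : rnorm (cls (bseq_mul (bseq_star x) x)) < c by rewrite ltrDl.
move/corona_norm_lt_near; apply: filterS => n.
have -> : rnorm (bseq_mul (bseq_star x) x n) = rnorm (x n) ^+ 2.
  exact: (rnorm_adjM (x n : fdalg (S n))).
move=> xc; rewrite -[leLHS]ger0_norm ?rnorm_ge0// -sqrtr_sqr ler_wsqrtr//.
exact: ltW.
Qed.

End CoronaAlgebra.

(** * The multiplication of the limit *)

Section LimitUnit.
Variables (R : realType) (S : cpc_system R).
Local Notation C := (sys_corona S).
Implicit Types (p q r : C).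

Lemma trans_completely_positive m n : (n <= m)%N ->
  completely_positive (@trans R S m n).
Proof.
move=> nm; rewrite -(subnK nm); elim: (m - n)%N => [|d IH] s a pa.
  have -> : map_mx (@trans R S (0 + n) n) a = a.
    by apply/matrixP => i j; rewrite mxE; exact: trans_id.
  exact: pa.
have -> : map_mx (@trans R S (d.+1 + n) n) a
    = map_mx (sys_step S (d + n)) (map_mx (@trans R S (d + n) n) a).
  by apply/matrixP => i j; rewrite !mxE; apply: transS; rewrite leq_addl.
by apply: sys_step_cp; exact: IH.
Qed.

Lemma transZ m n k (x : S n) : trans m n (k *: x) = k *: trans m n x.
Proof.
have t0 : trans m n (0 : S n) = 0.
  by have := trans_linear m (-1) (0 : S n) 0; rewrite scaler0 addr0 scaleN1r addNr.
by have := trans_linear m k x 0; rewrite t0 !addr0.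
Qed.

Lemma rnorm_trans m n (x : S n) : rnorm (trans m n x) <= rnorm x.
Proof. by rewrite -lecR -!rnormE trans_contractive. Qed.

Lemma rnorm_rho n (x : S n) : rnorm (rho n x) <= rnorm x.
Proof. by apply: corona_norm_le_near; near=> m; exact: rnorm_trans.
Unshelve. all: by end_near. Qed.

Definition lunit l : C := rho l (fdc_one (S l)).

Lemma lunit_star l : corona_star (lunit l) = lunit l.
Proof. by rewrite -rho_star fdc_star1. Qed.

Lemma rnorm_lunit_le l : rnorm (lunit l) <= 1.
Proof. exact: le_trans (rnorm_rho _) (rnorm_one_le (S l)). Qed.

Lemma rnorm_lunitM l p : rnorm (lunit l * p) <= rnorm p.
Proof.
apply: le_trans (rnorm_coronaM _ _) _.
by rewrite ler_piMl ?rnorm_ge0 ?rnorm_lunit_le.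
Qed.

Lemma rnorm_Mlunit l p : rnorm (p * lunit l) <= rnorm p.
Proof.
apply: le_trans (rnorm_coronaM _ _) _.
by rewrite ler_piMr ?rnorm_ge0 ?rnorm_lunit_le.
Qed.

(** The finite-dimensional bound applies to [trans m l] for large m. Its left side dominates |rho l
    z|^3, and its right side is controlled by the corona norm up to e. *)
Lemma rho_lower_bound l (z : S l) :
  rnorm (rho l z) ^+ 3 <= rnorm z ^+ 2 * rnorm (lunit l * rho l z).
Proof.
have rE m : (l <= m)%N -> rnorm (rho l z) <= rnorm (trans m l z).
  by move=> lm; rewrite -(rho_trans z lm); exact: rnorm_rho.
have [z0|z0] := eqVneq (rnorm z) 0.
  have -> : rnorm (rho l z) = 0.
    by apply/eqP; rewrite eq_le rnorm_ge0 -[X in _ <= X]z0 rnorm_rho.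
  by rewrite expr0n mulr_ge0 ?sqr_ge0 ?rnorm_ge0.
have {}z0 : 0 < rnorm z ^+ 2 by rewrite exprn_gt0// lt_neqAle eq_sym z0 rnorm_ge0.
rewrite -ler_pdivrMl//; apply/ler_addgt0Pr => e e0.
set c := rnorm _ + e.
have : rnorm (lunit l * rho l z) < c by rewrite ltrDl.
rewrite -clsM => /corona_norm_lt_near[N _ hN].
pose m := maxn N l; have lm : (l <= m)%N := leq_maxr _ _.
have {hN} := hN m (leq_maxl _ _); rewrite /= => hm.
rewrite ler_pdivrMl//; apply: le_trans _ (ler_wpM2l (ltW z0) (ltW hm)).
apply: (@le_trans _ _ (rnorm (trans m l z) ^+ 3)).
  by rewrite ler_pXn2r ?nnegrE ?rnorm_ge0//; exact: rE lm.
apply: (@completely_positive_lower_bound R (S l) (S m) (trans m l) z).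
- exact: trans_completely_positive.
- by move=> k w; exact: transZ.
- by move=> w; exact: rnorm_trans.
Qed.

(** Approximating r by [rho k x] and pushing x far enough along the system makes |trans l k x|
    almost |r|; [rho_lower_bound] then reads roughly |r|^3 <= |r|^2 c. *)
Lemma rnorm_le_lunit r c : in_limit r ->
  (\forall l \near \oo, rnorm (lunit l * r) <= c) -> rnorm r <= c.
Proof.
move=> /asboolP/limit_setP rL rc; rewrite leNgt; apply/negP => cr.
have c0 : 0 <= c.
  by case: rc => N _ /(_ N (leqnn _)); apply: le_trans; exact: rnorm_ge0.
(* With |r| = c + 8d the estimates give (c + 7d)^3 <= (c + 9d)^2 (c + d), which is false for d > 0:
   already the coefficients of c^2 d are 21 and 19. *)
pose d := (rnorm r - c) / 8; have d0 : 0 < d by rewrite divr_gt0 ?subr_gt0.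
have [k [x xr]] := rL _ d0.
have xlt : rnorm (rho k x) < rnorm r + d.
  rewrite -[rho k x](subKr r); apply: le_lt_trans (ler_rnormD _ _) _.
  by rewrite rnormN ltrD2l.
have xgt : rnorm r - d < rnorm (rho k x).
  rewrite ltrBlDr -{1}[r](subrK (rho k x)).
  by apply: le_lt_trans (ler_rnormD _ _) _; rewrite [ltRHS]addrC ltrD2r.
have xnear : \forall l \near \oo, rnorm (trans l k x) < rnorm r + d.
  exact: corona_norm_lt_near xlt.
suff : \forall l \near (\oo : set_system nat), False by case=> N _ /(_ N (leqnn _)).
near=> l.
have kl : (k <= l)%N by near: l; exact: nbhs_infty_ge.
have tl : rnorm (trans l k x) < rnorm r + d by near: l.
have rl : rnorm (lunit l * r) <= c by near: l.
have xl := rho_lower_bound (trans l k x); rewrite rho_trans// in xl.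
have ul : rnorm (lunit l * rho k x) <= c + d.
  have -> : lunit l * rho k x = lunit l * r - lunit l * (r - rho k x).
    by rewrite -mulrBr subKr.
  apply: le_trans (ler_rnormD _ _) _; rewrite rnormN lerD//.
  exact: le_trans (rnorm_lunitM _ _) (ltW xr).
have rE : rnorm r = c + 8 * d by rewrite /d mulrC divfK// addrC subrK.
have low : (c + 7 * d) ^+ 3 <= rnorm (rho k x) ^+ 3.
  rewrite ler_pXn2r ?nnegrE ?rnorm_ge0//; last by rewrite addr_ge0// mulr_ge0// ltW.
  by apply: le_trans _ (ltW xgt); rewrite rE; lra.
have up : rnorm (trans l k x) ^+ 2 * rnorm (lunit l * rho k x)
    <= (c + 9 * d) ^+ 2 * (c + d).
  apply: ler_pM => //; rewrite ?sqr_ge0 ?rnorm_ge0//.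
  rewrite ler_pXn2r ?nnegrE ?rnorm_ge0//; last first.
    by rewrite addr_ge0// mulr_ge0// ltW.
  by apply: le_trans (ltW tl) _; rewrite rE; lra.
have := le_trans low (le_trans xl up).
have : 0 <= c ^+ 2 * d by rewrite mulr_ge0 ?sqr_ge0// ltW.
have : 0 <= c * d ^+ 2 by rewrite mulr_ge0 ?sqr_ge0.
have : 0 < d ^+ 3 by rewrite exprn_gt0.
clear -c d; move: c d => c d; nra.
Unshelve. all: by end_near. Qed.

End LimitUnit.

(** * Approximate products and the product they determine *)

Section Bullet.
Variables (R : realType) (S : cpc_system R).
Local Notation C := (sys_corona S).
Local Notation E := (@lunit R S).
Implicit Types (p q r : C) (u v : nat -> C).

Definition vanishes u := forall e : R, 0 < e -> \forall l \near \oo, rnorm (u l) <= e.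

Lemma vanishesD u v : vanishes u -> vanishes v -> vanishes (fun l => u l + v l).
Proof.
move=> u0 v0 e e0; have e2 : 0 < e / 2 by rewrite divr_gt0.
apply: filterS2 (u0 _ e2) (v0 _ e2) => l ul vl.
by apply: le_trans (ler_rnormD _ _) _; rewrite (splitr e) lerD.
Qed.

Lemma vanishes_dominated (K : R) u v : vanishes u -> 0 <= K ->
  (forall l, rnorm (v l) <= K * rnorm (u l)) -> vanishes v.
Proof.
move=> u0 K0 vu e e0; have K1 : 0 < K + 1 by rewrite ltr_wpDl.
have := u0 _ (divr_gt0 e0 K1); apply: filterS => l; rewrite ler_pdivlMr// mulrC.
by apply: le_trans; apply: le_trans (vu l) _; rewrite ler_wpM2r ?rnorm_ge0// lerDl.
Qed.

Lemma vanishesZ k u : vanishes u -> vanishes (fun l => k *: u l).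
Proof.
move=> u0; apply: (vanishes_dominated u0 (cnorm_ge0 k)) => l.
by rewrite rnormZ.
Qed.

Lemma vanishesN u : vanishes u -> vanishes (fun l => - u l).
Proof.
by move=> u0; apply: (vanishes_dominated (K := 1) u0) => // l; rewrite rnormN mul1r.
Qed.

Lemma vanishesMl p u : vanishes u -> vanishes (fun l => p * u l).
Proof.
move=> u0; apply: (vanishes_dominated u0 (rnorm_ge0 p)) => l.
exact: rnorm_coronaM.
Qed.

Lemma vanishesMr p u : vanishes u -> vanishes (fun l => u l * p).
Proof.
move=> u0; apply: (vanishes_dominated u0 (rnorm_ge0 p)) => l.
by rewrite mulrC; exact: rnorm_coronaM.
Qed.

Lemma vanishes_lunitM u : vanishes u -> vanishes (fun l => E l * u l).
Proof.
by move=> u0; apply: (vanishes_dominated (K := 1) u0) => // l; rewrite mul1r rnorm_lunitM.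
Qed.

Lemma vanishes_Mlunit u : vanishes u -> vanishes (fun l => u l * E l).
Proof.
by move=> u0; apply: (vanishes_dominated (K := 1) u0) => // l; rewrite mul1r rnorm_Mlunit.
Qed.

Lemma eq_vanishes u v : u =1 v -> vanishes u -> vanishes v.
Proof. by move=> uv; rewrite (funext uv). Qed.

Lemma vanishes_lunit_eq0 r : in_limit r -> vanishes (fun l => E l * r) -> r = 0.
Proof.
move=> rL r0; apply: rnorm_eq0; apply/eqP; rewrite eq_le rnorm_ge0 andbT.
apply/ler_addgt0Pr => e e0; rewrite add0r.
by apply: rnorm_le_lunit => //; exact: r0.
Qed.

Lemma in_limitB p q : in_limit p -> in_limit q -> in_limit (p - q).
Proof.
move=> pL qL; have [_ /(_ (-1) q p qL pL)] := @in_limit_submod_closed R S.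
by rewrite scaleN1r addrC.
Qed.

(** Both sides are recorded because the involution exchanges them and associativity moves [E l]
    across a factor. *)
Definition lunit_near r p q (e : R) := \forall l \near \oo,
  rnorm (E l * r - p * q) <= e /\ rnorm (r * E l - p * q) <= e.

(* lunit plays the role of an order unit e commuting with the products of elements
   of the limit: "r is p \bullet q" means e r = r e = p q. *)
Definition is_bullet r p q := forall e, 0 < e -> lunit_near r p q e.

Lemma is_bulletP r p q : is_bullet r p q <->
  vanishes (fun l => E l * r - p * q) /\ vanishes (fun l => r * E l - p * q).
Proof.
split=> [h|[h1 h2] e e0].
  by split=> e /h; apply: filterS => l [].
by apply: filterS2 (h1 _ e0) (h2 _ e0).
Qed.

(** [rnorm_le_lunit] removes [E l] from the estimate of E l (r - r'). This serves both for
    uniqueness and for the Cauchy property. *)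
Lemma lunit_near_dist r r' p q e e' : in_limit r -> in_limit r' ->
  lunit_near r p q e -> lunit_near r' p q e' -> rnorm (r - r') <= e + e'.
Proof.
move=> rL r'L re r'e; apply: rnorm_le_lunit; first exact: in_limitB.
apply: filterS2 re r'e => l [h _] [h' _].
have -> : E l * (r - r') = (E l * r - p * q) - (E l * r' - p * q).
  by rewrite opprB addrA subrK mulrBr.
by apply: le_trans (ler_rnormD _ _) _; rewrite rnormN lerD.
Qed.

Lemma is_bullet_unique r r' p q : in_limit r -> in_limit r' ->
  is_bullet r p q -> is_bullet r' p q -> r = r'.
Proof.
move=> rL r'L rpq r'pq; apply/eqP; rewrite -subr_eq0; apply/eqP/rnorm_eq0/eqP.
rewrite eq_le rnorm_ge0 andbT; apply/ler_addgt0Pr => e e0; rewrite add0r (splitr e).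
have e2 : 0 < e / 2 by rewrite divr_gt0.
by apply: (lunit_near_dist rL r'L (rpq _ e2) (r'pq _ e2)).
Qed.

Lemma is_bullet_star r p q : is_bullet r p q ->
  is_bullet (corona_star r) (corona_star q) (corona_star p).
Proof.
move=> h e /h; apply: filterS => l [h1 h2]; split.
  by rewrite -[E l]lunit_star -!corona_starM -corona_starB rnorm_star.
by rewrite -[E l]lunit_star -!corona_starM -corona_starB rnorm_star.
Qed.

Lemma is_bullet_linearr k r r' p q q' : is_bullet r p q -> is_bullet r' p q' ->
  is_bullet (k *: r + r') p (k *: q + q').
Proof.
move=> /is_bulletP[h1 h2] /is_bulletP[h1' h2']; apply/is_bulletP; split.
  apply: eq_vanishes (vanishesD (vanishesZ k h1) h1') => l /=.
  by rewrite !mulrDr !coronaZr opprD addrACA -scalerBr.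
apply: eq_vanishes (vanishesD (vanishesZ k h2) h2') => l /=.
by rewrite mulrDl mulrDr coronaZl coronaZr opprD addrACA -scalerBr.
Qed.

Lemma is_bullet_linearl k r r' p p' q : is_bullet r p q -> is_bullet r' p' q ->
  is_bullet (k *: r + r') (k *: p + p') q.
Proof.
move=> /is_bulletP[h1 h2] /is_bulletP[h1' h2']; apply/is_bulletP; split.
  apply: eq_vanishes (vanishesD (vanishesZ k h1) h1') => l /=.
  by rewrite mulrDr mulrDl coronaZl coronaZr opprD addrACA -scalerBr.
apply: eq_vanishes (vanishesD (vanishesZ k h2) h2') => l /=.
by rewrite !mulrDl !coronaZl opprD addrACA -scalerBr.
Qed.

Lemma is_bullet_norm r p q : in_limit r -> is_bullet r p q -> rnorm r = rnorm (p * q).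
Proof.
move=> rL h; apply/eqP; rewrite eq_le; apply/andP; split.
  apply/ler_addgt0Pr => e e0; apply: rnorm_le_lunit => //.
  have := h _ e0; apply: filterS => l [hl _].
  rewrite -[E l * r](subrK (p * q)) addrC.
  by rewrite addrC; apply: le_trans (ler_rnormD _ _) _; rewrite addrC lerD2l.
apply/ler_addgt0Pr => e e0; have [N _ /(_ N (leqnn _))[hN _]] := h _ e0.
rewrite -[p * q](subKr (E N * r)); apply: le_trans (ler_rnormD _ _) _.
by rewrite rnormN lerD// rnorm_lunitM.
Qed.

(* With P = (p q) s and Q = p (q s) in the new product, E l * E l * P and
   E l * Q * E l, hence E l * E l * Q, both converge to the product p q s. *)
Lemma is_bullet_assoc a b P Q p q s : in_limit P -> in_limit Q ->
  is_bullet a p q -> is_bullet P a s -> is_bullet b q s -> is_bullet Q p b ->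
  P = Q.
Proof.
move=> PL QL /is_bulletP[a1 _] /is_bulletP[P1 _] /is_bulletP[_ b2] /is_bulletP[Q1 Q2].
have WL : in_limit (P - Q) by exact: in_limitB.
apply/eqP; rewrite -subr_eq0; apply/eqP; apply: vanishes_lunit_eq0 => //.
have hP : vanishes (fun l => E l * (E l * P) - p * q * s).
  apply: eq_vanishes (vanishesD (vanishes_lunitM P1) (vanishesMr s a1)) => l /=.
  by rewrite mulrBr mulrBl -[E l * a * s]mulrA addrA subrK.
(* The first summand exchanges E l E l Q for E l Q E l; the second takes E l Q E l to p b E l and
   then to p q s. *)
have hQ : vanishes (fun l => E l * (E l * Q) - p * q * s).
  have QE := vanishes_lunitM (vanishesD Q1 (vanishesN Q2)).
  have EQ := vanishesD (vanishes_Mlunit Q1) (vanishesMl p b2).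
  apply: eq_vanishes (vanishesD QE EQ) => l /=.
  rewrite opprB [_ - _ + (_ - _)]addrA subrK [X in X + _]mulrBr mulrBl mulrBr -!mulrA.
  by rewrite [_ - _ + (_ - _)]addrA subrK addrA subrK.
have hW : vanishes (fun l => E l * (E l * (P - Q))).
  apply: eq_vanishes (vanishesD hP (vanishesN hQ)) => l /=.
  by rewrite opprB addrA subrK !mulrBr.
(* One factor [E l] is removed by the C*-identity: |E l W|^2 <= |W| |E l E l W|. *)
move=> e e0; set W := P - Q in hW *.
have W1 : 0 < rnorm W + 1 by rewrite ltr_wpDl ?rnorm_ge0.
have := hW (e ^+ 2 / (rnorm W + 1)) _; rewrite divr_gt0 ?exprn_gt0// => /(_ isT).
apply: filterS => l; rewrite ler_pdivlMr// => hl.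
rewrite -(@ler_pXn2r _ 2)// ?nnegrE ?rnorm_ge0 ?(ltW e0)//.
rewrite -rnorm_corona_starM corona_starM lunit_star -mulrA.
apply: le_trans (rnorm_coronaM _ _) (le_trans _ hl).
by rewrite rnorm_star mulrC ler_wpM2l ?rnorm_ge0// lerDl.
Qed.

Section System.
Hypothesis hS : cpcstar_system S.

(** The left estimate is the system condition as m tends to infinity; the right one is the adjoint
    of the left one for [fdc_star y] and [fdc_star x]. *)
Lemma lunit_near_rho k (x y : S k) (e : R) : 0 < e -> \forall n \near \oo,
  lunit_near (rho n (fdc_mul (trans n k x) (trans n k y))) (rho k x) (rho k y) e.
Proof.
move=> e0.
have left (u v : S k) : exists M, forall n l, (M < n)%N -> (M < l)%N ->
    rnorm (E l * rho n (fdc_mul (trans n k u) (trans n k v)) - rho k u * rho k v) <= e.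
  have [M _ hM] := hS u v e0; exists M => n l Mn Ml.
  rewrite -!clsM -clsB; apply: corona_norm_le_near; near=> m.
  rewrite -lecR -rnormE ltW// hM// ?Mn ?Ml /=.
    by near: m; exact: nbhs_infty_gt.
  by near: m; exact: nbhs_infty_gt.
have [M hM] := left x y; have [N hN] := left (fdc_star y) (fdc_star x).
near=> n; near=> l.
have Ml : (M < l)%N by near: l; exact: nbhs_infty_gt.
have Nl : (N < l)%N by near: l; exact: nbhs_infty_gt.
have Mn : (M < n)%N by near: n; exact: nbhs_infty_gt.
have Nn : (N < n)%N by near: n; exact: nbhs_infty_gt.
split; first exact: hM.
rewrite -rnorm_star corona_starB !corona_starM lunit_star.
by have := hN n l Nn Nl; rewrite !trans_star -(cstar_starM (fdc_cstar _)) !rho_star.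
Unshelve. all: by end_near. Qed.

Lemma in_limit_rho k (x : S k) : in_limit (rho k x).
Proof. exact: (limit_valP (limit_rho k x)). Qed.

Lemma lunit_near_ex p q (e : R) : in_limit p -> in_limit q -> 0 < e ->
  exists2 r, in_limit r & lunit_near r p q e.
Proof.
move=> /asboolP/limit_setP pL /asboolP/limit_setP qL e0.
pose s := rnorm p + rnorm q + 1.
have s0 : 0 < s by rewrite ltr_wpDl// addr_ge0 ?rnorm_ge0.
(* Moving p and q by d changes their product by at most d (|q| + d) + |p| d <= d s <= e / 2; the
   other half of e goes to [lunit_near_rho]. *)
pose d := Num.min 1 (e / 2 / s).
have d0 : 0 < d by rewrite lt_min ltr01 !divr_gt0.
have d1 : d <= 1 by rewrite ge_min lexx.
have ds : d * s <= e / 2 by rewrite -ler_pdivlMr// ge_min lexx orbT.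
have [i [x0 px]] := pL _ d0; have [j [y0 qy]] := qL _ d0.
pose k := maxn i j; pose x := trans k i x0; pose y := trans k j y0.
rewrite -(rho_trans x0 (leq_maxl i j) : rho k x = _) in px.
rewrite -(rho_trans y0 (leq_maxr i j) : rho k y = _) in qy.
have xy : rnorm (rho k x * rho k y - p * q) <= e / 2.
  have -> : rho k x * rho k y - p * q
      = (rho k x - p) * rho k y + p * (rho k y - q).
    by rewrite mulrBl mulrBr addrA subrK.
  have yq : rnorm (rho k y) <= rnorm q + d.
    rewrite -[rho k y](subrK q); apply: le_trans (ler_rnormD _ _) _.
    by rewrite [leRHS]addrC lerD2r rnormB ltW.
  apply: le_trans (ler_rnormD _ _) (le_trans _ ds).
  apply: (@le_trans _ _ (d * (rnorm q + d) + rnorm p * d)).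
    apply: lerD; apply: le_trans (rnorm_coronaM _ _) _; apply: ler_pM;
      by rewrite ?rnorm_ge0// rnormB ltW.
  rewrite [rnorm p * d]mulrC -mulrDr ler_wpM2l ?(ltW d0)//.
  by rewrite addrAC [rnorm q + _]addrC /s lerD2l.
have e2 : 0 < e / 2 by rewrite divr_gt0.
have [N _ /(_ N (leqnn _)) hN] := lunit_near_rho x y e2.
exists (rho N (fdc_mul (trans N k x) (trans N k y))); first exact: in_limit_rho.
move: hN; apply: filterS => l [h1 h2]; rewrite (splitr e); split.
  rewrite -[X in rnorm (X - _)](subrK (rho k x * rho k y)) -addrA.
  by apply: le_trans (ler_rnormD _ _) _; exact: lerD.
rewrite -[X in rnorm (X - _)](subrK (rho k x * rho k y)) -addrA.
by apply: le_trans (ler_rnormD _ _) _; exact: lerD.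
Qed.

End System.

(** The corona is complete and the limit is closed in it; arbitrarily small [e i] place p in the
    closure. *)
Lemma limit_complete (r : nat -> C) (e : nat -> R) :
  (forall i, in_limit (r i)) -> (forall d, 0 < d -> exists i, e i < d) ->
  (forall i j, (i <= j)%N -> rnorm (r i - r j) < e i) ->
  exists2 p, in_limit p & forall i, rnorm (p - r i) <= e i.
Proof.
move=> rL e0 re; have [p pr] := corona_complete re; exists p => //.
apply/asboolP/limit_setP => d d0; have d2 : 0 < d / 2 by rewrite divr_gt0.
have [i ei] := e0 _ d2; have /asboolP/limit_setP/(_ _ d2)[n [x xr]] := rL i.
exists n, x; rewrite -[p](subrK (r i)) -addrA (splitr d).
apply: le_lt_trans (ler_rnormD _ _) _; apply: ltrD => //.
exact: le_lt_trans (pr i) ei.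
Qed.

Lemma is_bullet_ex p q : cpcstar_system S -> in_limit p -> in_limit q ->
  exists2 r, in_limit r & is_bullet r p q.
Proof.
move=> hS pL qL; pose e n : R := n.+1%:R^-1.
have e0 n : 0 < e n by rewrite invr_gt0.
have /choice[r rP] : forall n, exists r, in_limit r /\ lunit_near r p q (e n).
  by move=> n; have [r] := lunit_near_ex hS pL qL (e0 n); exists r.
(* Two approximate products differ by at most e i + e j <= 2 e i; the factor 3 makes this strict. *)
have [|||r' r'L r'r] := @limit_complete r (fun n => 3 * e n).
- by move=> i; have [] := rP i.
- move=> d d0; have d3 : 0 < d / 3 by rewrite divr_gt0.
  have [N _ /(_ N (leqnn _)) hN] := near_infty_natSinv_lt (PosNum d3).
  by exists N; rewrite mulrC -ltr_pdivlMr.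
- move=> i j ij; have [riL ri] := rP i; have [rjL rj] := rP j.
  apply: le_lt_trans (lunit_near_dist riL rjL ri rj) _.
  have ji : e j <= e i by rewrite lef_pV2 ?posrE// ler_nat ltnS.
  by have := e0 i; lra.
(* The error is at most 3 e N from r' to [r N] plus e N from [r N] to the product. *)
exists r' => // d d0; have d4 : 0 < d / 4 by rewrite divr_gt0.
have [N _ /(_ N (leqnn _)) hN] := near_infty_natSinv_lt (PosNum d4).
have {hN} : e N < d / 4 by [].
have [_] := rP N; have := r'r N => rN near_N eN.
have rd : rnorm (r' - r N) + e N <= d by lra.
move: near_N; apply: filterS => l [h1 h2]; split.
  rewrite -[r'](subrK (r N)) mulrDr -addrA; apply: le_trans (ler_rnormD _ _) _.
  by apply: le_trans (lerD (rnorm_lunitM _ _) h1) _.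
rewrite -[r'](subrK (r N)) mulrDl -addrA; apply: le_trans (ler_rnormD _ _) _.
by apply: le_trans (lerD (rnorm_Mlunit _ _) h2) _.
Qed.

End Bullet.

(** * Completeness of the limit for Cauchy filters *)

Section LimitComplete.
Variables (R : realType) (S : cpc_system R).

Lemma limit_rnormE (x : limit S) : rnorm x = rnorm (limit_val x).
Proof. by []. Qed.

(** The filter contains balls of radius 1/(n+1); any two of them meet, so their centres form a
    Cauchy sequence, and the filter converges to its limit. *)
Lemma limit_cauchy_cvg (F : set_system (limit S)) : ProperFilter F ->
  cauchy F -> cvg F.
Proof.
move=> FF /cauchyP Fc; pose e n : R := n.+1%:R^-1.
have e0 n : 0 < e n by rewrite invr_gt0.
have /choice[x xF] : forall n, exists x, F (ball x (e n)%:C).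
  by move=> n; apply: Fc; rewrite ltcR.
have xy i j : rnorm (x i - x j) < e i + e j.
  have [z [iz jz]] := filter_ex (filterI (xF i) (xF j)).
  move: iz jz; rewrite -!ball_normE /= !rnormE !ltcR => iz jz.
  rewrite -[x i](subrK z) -addrA; apply: le_lt_trans (ler_rnormD _ _) _.
  by rewrite ltrD// rnormB.
have [|||p pL px] := @limit_complete R S (fun i => limit_val (x i)) (fun n => 3 * e n).
- by move=> i; exact: limit_valP.
- move=> d d0; have d3 : 0 < d / 3 by rewrite divr_gt0.
  have [N _ /(_ N (leqnn _)) hN] := near_infty_natSinv_lt (PosNum d3).
  by exists N; rewrite mulrC -ltr_pdivlMr.
- move=> i j ij; apply: lt_le_trans (xy i j) _.
  have ji : e j <= e i by rewrite lef_pV2 ?posrE// ler_nat ltnS.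
  by have := e0 i; lra.
apply/cvg_ex; exists (Limit pL); apply/cvgrPdist_lt => d d0.
have dE : d = (complex.Re d)%:C by rewrite RRe_real ?gtr0_real.
have {}d0 : 0 < complex.Re d by rewrite -ltcR -dE.
have d4 : 0 < complex.Re d / 4 by rewrite divr_gt0.
have [N _ /(_ N (leqnn _)) hN] := near_infty_natSinv_lt (PosNum d4).
have {}hN : e N < complex.Re d / 4 by [].
have := xF N; apply: filterS => z; rewrite -ball_normE /= rnormE ltcR => xz.
rewrite rnormE dE ltcR -[Limit pL](subrK (x N)) -addrA.
apply: le_lt_trans (ler_rnormD _ _) _.
have := px N; rewrite -[rnorm _]/(rnorm (Limit pL - x N)) => pN.
by clear -pN xz hN; lra.
Qed.

End LimitComplete.

Theorem propositionB (R : realType) (S : cpc_system R) (hS : cpcstar_system S) :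
  exists bul : limit S -> limit S -> limit S,
    [/\ associative bul,
        (forall a, linear (bul a)) /\ (forall b, linear (bul^~ b)),
        (forall (k : nat) (x y : S k),
           limit_rho n (fdc_mul (trans n k x) (trans n k y)) @[n --> \oo]
             --> bul (limit_rho k x) (limit_rho k y))
      & cstar_algebra bul (@limit_star R S)].
Proof.
have /choice[b bP] : forall pq : limit S * limit S, exists r : limit S,
    is_bullet (limit_val r) (limit_val pq.1) (limit_val pq.2).
  move=> [[p pL] [q qL]] /=; have [r rL rP] := is_bullet_ex hS pL qL.
  by exists (Limit rL).
pose bul p q := b (p, q).
have bulP p q : is_bullet (limit_val (bul p q)) (limit_val p) (limit_val q) := bP (p, q).
(* Each algebraic identity for [bul] now reduces to an [is_bullet] statement in the corona. *)
have uniq r p q : is_bullet (limit_val r) (limit_val p) (limit_val q) -> bul p q = r.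
  move=> rP; apply: val_inj.
  exact: (is_bullet_unique (limit_valP _) (limit_valP _) (bulP p q) rP).
have normE p q : rnorm (bul p q) = rnorm (limit_val p * limit_val q).
  by rewrite limit_rnormE; exact: is_bullet_norm (limit_valP _) (bulP p q).
have A : associative bul.
  move=> p q s; apply: val_inj; apply/esym.
  exact: (is_bullet_assoc (limit_valP _) (limit_valP _) (bulP p q) (bulP _ s)
    (bulP q s) (bulP p _)).
have linr p : linear (bul p).
  by move=> k q q'; apply: uniq; exact: (is_bullet_linearr k (bulP p q) (bulP p q')).
have linl q : linear (bul^~ q).
  by move=> k p p'; apply: uniq; exact: (is_bullet_linearl k (bulP p q) (bulP p' q)).
exists bul; split => //.
- move=> k x y; apply/cvgrPdist_lt => d d0.
  have dE : d = (complex.Re d)%:C by rewrite RRe_real ?gtr0_real.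
  have {}d0 : 0 < complex.Re d by rewrite -ltcR -dE.
  have d3 : 0 < complex.Re d / 3 by rewrite divr_gt0.
  (* The exact and the approximate product each err by at most d/3, so they are within 2d/3 < d of
     each other. *)
  have := lunit_near_rho hS x y d3; apply: filterS => n hn.
  rewrite rnormE dE ltcR limit_rnormE.
  have := lunit_near_dist (limit_valP _) (in_limit_rho _)
    (bulP (limit_rho k x) (limit_rho k y) _ d3) hn.
  by move/le_lt_trans; apply; lra.
split => //.
- by move=> p; apply: val_inj; exact: corona_starK.
- by move=> k p q; apply: val_inj; exact: corona_star_semilinear.
- by move=> p q; apply/esym/uniq; exact: is_bullet_star (bulP p q).
- move=> p q; rewrite !rnormE -rmorphM lecR normE; exact: rnorm_coronaM.
- by move=> p; rewrite !rnormE -rmorphXn normE rnorm_corona_starM.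
- exact: limit_cauchy_cvg.
Qed.
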